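(* Let $k$ be a perfect field with algebraic closure $\bar{k}$, and let $\mathcal{C}\subset\mathbb{P}^2$ be a smooth projective plane curve over $k$ of degree $\geq 2$. Let $\mathcal{C}_\infty$ be the set of points at infinity of $\mathcal{C}$ and $\mathcal{C}_0=\mathcal{C}\setminus\mathcal{C}_\infty$ the corresponding affine part. Assume that the points of $\mathcal{C}_\infty$ are not rational over $k$ and are all conjugate to each other by elements of the Galois group $G_{\bar{k}/k}$. Then the affine coordinate ring $R=k[\mathcal{C}_0]$ does not have the property that every invertible $2\times 2$ matrix with entries in $R$ is a product of elementary matrices over $R$; that is, there exists an invertible $2\times 2$ matrix over $R$ that is not a product of elementary matrices over $R$.
   Context: A smooth projective curve over $k$ is a projective variety of dimension one, irreducible over $\bar{k}$, defined over $k$, and nonsingular at all its $\bar{k}$-points. The points at infinity $\mathcal{C}_\infty$ are the $\bar{k}$-points of $\mathcal{C}$ on the chosen line at infinity of $\mathbb{P}^2$ (defined over $k$); if the affine part $\mathcal{C}_0$ is defined by $F(X,Y)=0$ with $F\in k[X,Y]$, then $k[\mathcal{C}_0]=k[X,Y]/(F)$. Elementary matrices are the invertible matrices corresponding to elementary row operations: matrices differing from the identity in one off-diagonal entry, permutation (row-swap) matrices, and matrices obtained from the identity by replacing a diagonal entry with a unit of $R$. *)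

(* Defs.v *)
From HB Require Import structures.
From mathcomp Require Import all_boot all_order all_algebra all_fingroup all_field.
From mathcomp Require Import ring_quotient generic_quotient.
From mathcomp Require Import boolp mpoly.

Set Implicit Arguments.
Unset Strict Implicit.
Unset Printing Implicit Defensive.

Import GRing.Theory.

Local Open Scope ring_scope.

Definition perfect_field (k : fieldType) : Prop :=
  forall p : {poly k}, irreducible_poly p -> separable_poly p.

Definition is_algebraic_closure (k : fieldType) (kbar : closedFieldType)
    (iota : {rmorphism k -> kbar}) : Prop :=
  forall x : kbar, algebraicOver iota x.

(* [sigma] belongs to the group G_{kbar/k}. *)
Definition galois_aut (k : fieldType) (kbar : closedFieldType)
    (iota : {rmorphism k -> kbar}) (sigma : {rmorphism kbar -> kbar}) : Prop :=
  bijective sigma /\ (forall x : k, sigma (iota x) = iota x).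

(* Points of the projective plane over [kbar] are given by nonzero vectors of
   homogeneous coordinates [X : Y : Z], two vectors defining the same point
   when they are proportional; the predicates on vectors below are invariant
   under nonzero scaling. *)
Definition same_point (F : fieldType) (v w : 'rV[F]_3) : Prop :=
  exists2 c : F, c != 0 & v = c *: w.

Definition rational_point (k : fieldType) (kbar : closedFieldType)
    (iota : {rmorphism k -> kbar}) (v : 'rV[kbar]_3) : Prop :=
  exists w : 'rV[k]_3, same_point v (map_mx iota w).

Definition conjugate_points (k : fieldType) (kbar : closedFieldType)
    (iota : {rmorphism k -> kbar}) (v w : 'rV[kbar]_3) : Prop :=
  exists2 sigma : {rmorphism kbar -> kbar},
    galois_aut iota sigma & same_point (map_mx sigma v) w.

Definition eval_at (F : fieldType) (H : {mpoly F[3]}) (v : 'rV[F]_3) : F :=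
  H.@[fun i => v 0 i].

Definition on_curve (k : fieldType) (kbar : closedFieldType)
    (iota : {rmorphism k -> kbar}) (H : {mpoly k[3]}) (v : 'rV[kbar]_3) : Prop :=
  v != 0 /\ eval_at (map_mpoly iota H) v = 0.

(* The line at infinity is Z = 0. *)
Definition at_infinity (k : fieldType) (kbar : closedFieldType)
    (iota : {rmorphism k -> kbar}) (H : {mpoly k[3]}) (v : 'rV[kbar]_3) : Prop :=
  on_curve iota H v /\ v 0 ord_max = 0.

(* The units of {mpoly F[n]} are the nonzero constants; the zero polynomial is
   excluded because 0 = 0 * 0. *)
Definition irreducible_mpoly (F : fieldType) (n : nat) (p : {mpoly F[n]}) :
    Prop :=
  p \isn't a GRing.unit /\
  (forall a b : {mpoly F[n]},
     p = a * b -> a \is a GRing.unit \/ b \is a GRing.unit).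

Definition smooth_plane_curve (k : fieldType) (kbar : closedFieldType)
    (iota : {rmorphism k -> kbar}) (d : nat) (H : {mpoly k[3]}) : Prop :=
  [/\ H \is d.-homog,
      irreducible_mpoly (map_mpoly iota H)
    & forall v : 'rV[kbar]_3, on_curve iota H v ->
        exists i : 'I_3, eval_at (mderiv i (map_mpoly iota H)) v != 0].

(* Quotient of a commutative ring by a principal ideal.  The library puts a ring
   structure on {ideal_quot I} only when I comes with a proof that it is proper;
   its additive quotient is reused here, with the multiplication induced on
   classes, so that no such proof is needed. *)
Definition principal_ideal (A : comNzRingType) (a : A) : {pred A} :=
  fun x => `[< exists c : A, x = c * a >].

Lemma principal_ideal_zmod_closed (A : comNzRingType) (a : A) :
  zmod_closed (principal_ideal a).
Proof.
split; first by apply/asboolP; exists 0; rewrite mul0r.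
move=> x y /asboolP[c ->] /asboolP[e ->].
by apply/asboolP; exists (c - e); rewrite mulrBl.
Qed.

HB.instance Definition _ (A : comNzRingType) (a : A) :=
  GRing.isZmodClosed.Build A (principal_ideal a)
    (principal_ideal_zmod_closed a).

Definition quot_ring (A : comNzRingType) (a : A) : Type :=
  {ideal_quot (principal_ideal a)}.

HB.instance Definition _ (A : comNzRingType) (a : A) :=
  GRing.Zmodule.on (quot_ring a).

Definition quot_pi (A : comNzRingType) (a : A) (x : A) : quot_ring a :=
  (\pi_{ideal_quot (principal_ideal a)} x)%qT.

Definition quot_one (A : comNzRingType) (a : A) : quot_ring a := quot_pi a 1.

Definition quot_mul (A : comNzRingType) (a : A) (x y : quot_ring a) :
    quot_ring a :=
  quot_pi a (repr (x : {ideal_quot (principal_ideal a)}) *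
             repr (y : {ideal_quot (principal_ideal a)})).

Lemma quot_pi_eq (A : comNzRingType) (a x y : A) :
  quot_pi a x = quot_pi a y <-> exists c : A, x - y = c * a.
Proof.
rewrite /quot_pi; split.
  by move/eqP; rewrite -Quotient.idealrBE => /asboolP.
by move=> h; apply/eqP; rewrite -Quotient.idealrBE; apply/asboolP.
Qed.

Lemma quot_piD (A : comNzRingType) (a x y : A) :
  quot_pi a (x + y) = quot_pi a x + quot_pi a y.
Proof. by rewrite /quot_pi raddfD. Qed.

Lemma quot_pi_surj (A : comNzRingType) (a : A) (u : quot_ring a) :
  exists x : A, u = quot_pi a x.
Proof.
by exists (repr (u : {ideal_quot (principal_ideal a)})); rewrite /quot_pi reprK.
Qed.

Lemma quot_piM (A : comNzRingType) (a x y : A) :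
  quot_pi a (x * y) = quot_mul (quot_pi a x) (quot_pi a y).
Proof.
rewrite /quot_mul; set x' := repr _; set y' := repr _.
have /quot_pi_eq[c Hc] : quot_pi a x = quot_pi a x' by rewrite /quot_pi reprK.
have /quot_pi_eq[e He] : quot_pi a y = quot_pi a y' by rewrite /quot_pi reprK.
apply/quot_pi_eq; exists (c * y + x' * e).
by rewrite mulrDl mulrAC -Hc -mulrA -He mulrBl mulrBr addrA subrK.
Qed.

Lemma quot_mulA (A : comNzRingType) (a : A) : associative (@quot_mul A a).
Proof.
move=> u v w; have [x ->] := quot_pi_surj u; have [y ->] := quot_pi_surj v.
by have [z ->] := quot_pi_surj w; rewrite -!quot_piM mulrA.
Qed.

Lemma quot_mulC (A : comNzRingType) (a : A) : commutative (@quot_mul A a).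
Proof.
move=> u v; have [x ->] := quot_pi_surj u; have [y ->] := quot_pi_surj v.
by rewrite -!quot_piM mulrC.
Qed.

Lemma quot_mul1 (A : comNzRingType) (a : A) :
  left_id (quot_one a) (@quot_mul A a).
Proof. by move=> u; have [x ->] := quot_pi_surj u; rewrite -quot_piM mul1r. Qed.

Lemma quot_mulDl (A : comNzRingType) (a : A) :
  left_distributive (@quot_mul A a) +%R.
Proof.
move=> u v w; have [x ->] := quot_pi_surj u; have [y ->] := quot_pi_surj v.
have [z ->] := quot_pi_surj w.
by rewrite -quot_piD -!quot_piM -quot_piD mulrDl.
Qed.

HB.instance Definition _ (A : comNzRingType) (a : A) :=
  GRing.Zmodule_isComPzRing.Build (quot_ring a)
    (@quot_mulA A a) (@quot_mulC A a) (@quot_mul1 A a) (@quot_mulDl A a).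

(* F(X, Y) = H(X, Y, 1) *)
Definition dehomogenize (k : fieldType) (H : {mpoly k[3]}) : {mpoly k[2]} :=
  H \mPo [tuple 'X_0; 'X_1; 1].

(* k[C_0] = k[X, Y] / (F) *)
Definition affine_coordinate_ring (k : fieldType) (H : {mpoly k[3]}) :
    comPzRingType :=
  quot_ring (dehomogenize H).

Definition unit_element (R : comPzRingType) (u : R) : Prop :=
  exists v : R, u * v = 1.

Definition invertible_mx (R : comPzRingType) (n : nat) (A : 'M[R]_n) : Prop :=
  exists B : 'M[R]_n, A *m B = 1%:M /\ B *m A = 1%:M.

Definition elementary_mx (R : comPzRingType) (n : nat) (E : 'M[R]_n) : Prop :=
  [\/ exists i j : 'I_n, exists2 a : R,
        i != j & E = 1%:M + a *: delta_mx i j,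
      exists i j : 'I_n, E = tperm_mx i j
    | exists i : 'I_n, exists2 u : R,
        unit_element u & E = diag_mx (\row_j (if j == i then u else 1))].

Definition product_of_elementary (R : comPzRingType) (n : nat) (A : 'M[R]_n) :
    Prop :=
  exists2 s : seq 'M[R]_n,
    (forall E, E \in s -> elementary_mx E) &
    A = \big[mulmx/1%:M]_(E <- s) E.

(* Main.v *)
Require Import Defs.
From HB Require Import structures.
From mathcomp Require Import all_boot all_order all_algebra all_fingroup all_field.
From mathcomp Require Import mpoly.
From mathcomp Require Import boolp ring zify.

(* Write F for the dehomogenization of H and f = H(X, 1, 0).  As the points at
   infinity are conjugate, f = c h^e with h of degree n minimal over k for any
   root theta, and n > 1 because theta is not in k.  With w the
   homogenization of h evaluated at (x, y), the monomials x^a y^b w^i with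
   a < n and i < e form a k-basis of R.  A point at infinity gives x, y, w the
   pole orders e, e, ne - 1 and leading coefficients theta al, al, be; when
   e > 1, smoothness is what makes be nonzero.  As ne - 1 = -1 mod e and
   1, theta, ..., theta^(n-1) are independent over k, the basis monomials of a
   given pole order have leading coefficients independent over k.  Hence the
   pole order is a degree function on R, and its elements of degree 0 are
   constants.
     For such a ring, the argument of P. M. Cohn shows that the first row of a
   product of elementary matrices is a row (a, b) with deg a > deg b times a
   matrix of GL_2(k).  If F = phi(X) + Y psi(X, Y) then
   [[1 + x phi, y phi], [x^2 psi, 1 - x phi]] has determinant 1 in R, whereas
   the leading coefficients of 1 + x phi and y phi have ratio theta, which is
   not in k: every nonzero k-combination of them has the same degree. *)

Set Implicit Arguments.
Unset Strict Implicit.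
Unset Printing Implicit Defensive.

Import GRing.Theory.

Local Open Scope ring_scope.

(** * Products of elementary matrices *)

Lemma ord2P (i : 'I_2) : i = 0 \/ i = 1.
Proof. by case: i => [[|[|]]] // ?; [left|right]; apply: val_inj. Qed.

Lemma mulmx2E (R : pzSemiRingType) (m p : nat) (A : 'M[R]_(m, 2))
    (B : 'M[R]_(2, p)) i j :
  (A *m B) i j = A i 0 * B 0 j + A i 1 * B 1 j.
Proof.
rewrite mxE !big_ord_recl big_ord0 addr0.
by congr (A _ _ * B _ _ + A _ _ * B _ _); apply: val_inj.
Qed.

Section EuclideanRows.

Context (k : fieldType) (R : comPzRingType) (kappa : {rmorphism k -> R}).

(** A step multiplies the row on the right by [[r, 1], [1, 0]] with r not in k, so that degrees rise
    strictly whenever R has a degree function with constants in degree 0. *)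
Inductive euclidean_row : R -> R -> Prop :=
| EuclideanUnit u of u != 0 : euclidean_row (kappa u) 0
| EuclideanStep a b r of euclidean_row a b & (forall c, r <> kappa c) :
    euclidean_row (b + r * a) a.

(** This class contains (1, 0) and, when the units of R are constants, is stable under right
    multiplication by elementary matrices. *)
Definition reducible_row (a b : R) : Prop :=
  exists s t : R, exists g11 g12 g21 g22 : k,
    [/\ euclidean_row s t, g11 * g22 - g12 * g21 != 0,
        a = s * kappa g11 + t * kappa g21 & b = s * kappa g12 + t * kappa g22].

Lemma reducible_row_mul (a b : R) (m11 m12 m21 m22 : k) :
    reducible_row a b -> m11 * m22 - m12 * m21 != 0 ->
  reducible_row (a * kappa m11 + b * kappa m21) (a * kappa m12 + b * kappa m22).
Proof.
move=> [s [t [g11 [g12 [g21 [g22 [st g0 -> ->]]]]]]] m0.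
exists s, t, (g11 * m11 + g12 * m21), (g11 * m12 + g12 * m22),
  (g21 * m11 + g22 * m21), (g21 * m12 + g22 * m22).
split=> //; try by rewrite !rmorphD !rmorphM /=; ring.
rewrite [X in X != 0](_ : _ = (g11 * g22 - g12 * g21) * (m11 * m22 - m12 * m21)).
  by rewrite mulf_neq0.
by ring.
Qed.

Lemma reducible_row_swap (a b : R) : reducible_row a b -> reducible_row b a.
Proof.
move=> ab; have := reducible_row_mul (m11 := 0) (m12 := 1) (m21 := 1)
  (m22 := 0) ab.
rewrite !rmorph0 !rmorph1 !mulr0 !mulr1 addr0 !add0r; apply.
by rewrite oppr_eq0 oner_neq0.
Qed.

Lemma euclidean_reducible (a b : R) : euclidean_row a b -> reducible_row a b.
Proof.
move=> ab; exists a, b, 1, 0, 0, 1; split=> //.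
- by rewrite mulr1 mulr0 subr0 oner_neq0.
- by rewrite rmorph1 rmorph0 mulr1 mulr0 addr0.
- by rewrite rmorph1 rmorph0 mulr1 mulr0 add0r.
Qed.

Lemma nonconst_affine (r : R) (a b : k) : a != 0 ->
  (forall c, r <> kappa c) -> forall c, kappa a * r + kappa b <> kappa c.
Proof.
move=> a0 rN c E; apply: (rN (a^-1 * (c - b))).
by rewrite rmorphM rmorphB -E addrK mulrA -rmorphM mulVf // rmorph1 mul1r.
Qed.

(** The last step absorbs the lower triangular matrix: its quotient r becomes (x/z) r + y/z, still
    not constant, and the entries of the preceding row are only rescaled by z and x. *)
Lemma euclidean_row_lower (a b : R) (x y z : k) : euclidean_row a b ->
  x != 0 -> z != 0 -> euclidean_row (kappa x * a + kappa y * b) (kappa z * b).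
Proof.
move=> ab; elim: ab x y z => {a b} [u u0|a b r _ IH rN] x y z x0 z0.
  by rewrite !mulr0 addr0 -rmorphM; apply: EuclideanUnit; rewrite mulf_neq0.
have -> : kappa x * (b + r * a) + kappa y * a =
    kappa x * b + (kappa (x / z) * r + kappa (y / z)) * (kappa z * a).
  rewrite !rmorphM /=.
  have zz : kappa z^-1 * kappa z = 1 by rewrite -rmorphM mulVf // rmorph1.
  transitivity (kappa x * b + (kappa x * r * a + kappa y * a)
      * (kappa z^-1 * kappa z)); last by ring.
  by rewrite zz; ring.
apply: EuclideanStep; last by apply: nonconst_affine; rewrite // mulf_neq0 ?invr_eq0.
by have := IH z 0 x z0 x0; rewrite rmorph0 mul0r addr0.
Qed.

(* By the Bruhat decomposition of GL_2(k) only a lower triangular or an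
   antitriangular matrix has to be moved past the transvection. *)
Lemma reducible_row_transvection (a b r : R) :
  reducible_row a b -> reducible_row a (b + r * a).
Proof.
have [[c ->]|/forallNP rN] := pselect (exists c, r = kappa c).
  move=> ab; have H := reducible_row_mul (m11 := 1) (m12 := c) (m21 := 0)
    (m22 := 1) ab.
  rewrite mulr0 mulr1 subr0 oner_neq0 in H.
  by move: (H isT); congr reducible_row; rewrite rmorph1 ?rmorph0; ring.
move=> [s [t [g11 [g12 [g21 [g22 [st g0 -> ->]]]]]]].
have [g11_0|g11N] := eqVneq g11 0; last first.
  (* With this Schur complement the matrix is [[g11, 0], [g21, z]] times [[1, g12/g11], [0, 1]]. The
     first factor keeps the row Euclidean, and r + g12/g11 is the quotient of a new step. *)
  pose z := g22 - g12 * g21 / g11.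
  have z0 : z != 0.
    apply: contraNneq g0 => z0.
    by rewrite -(mulr0 g11) -z0 /z; apply/eqP; field.
  have := euclidean_row_lower g21 st g11N z0 => /EuclideanStep H.
  have {}H := H _ (nonconst_affine (b := g12 / g11) (oner_neq0 k) rN).
  move/euclidean_reducible/reducible_row_swap: H.
  have e1 : kappa g11 * kappa (g12 / g11) = kappa g12.
    by rewrite -rmorphM mulrC divfK.
  have e2 : kappa z = kappa g22 - kappa g21 * kappa (g12 / g11).
    by rewrite /z rmorphB -rmorphM /=; congr (_ - kappa _); field.
  congr reducible_row; first by ring.
  by rewrite e2 rmorph1 -e1; ring.
move: g0; rewrite g11_0 mul0r sub0r oppr_eq0 mulf_eq0 negb_or => /andP[g12N g21N].
case: st => [u u0|a' b' r' a'b' r'N].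
  rewrite rmorph0 mulr0 !mul0r addr0 mulr0 !addr0.
  apply/reducible_row_swap; rewrite -rmorphM.
  apply/euclidean_reducible/EuclideanUnit.
  by rewrite mulf_neq0.
rewrite rmorph0 mulr0 add0r.
(* The quotients r' and r merge into r''. If r'' is a constant, the last step disappears and the row
   is (a', b') times a matrix of GL_2(k). Otherwise r''/g21 is the quotient of a step from the row
   (g21 a', g12 b'). *)
pose r'' := r' * kappa g12 + kappa g22 + r * kappa g21.
have -> : (b' + r' * a') * kappa g12 + a' * kappa g22 + r * (a' * kappa g21) =
    b' * kappa g12 + r'' * a' by rewrite /r''; ring.
have [[c ->]|/forallNP r''N] := pselect (exists c, r'' = kappa c).
  have H := reducible_row_mul (m11 := g21) (m12 := c) (m21 := 0)
    (m22 := g12) (euclidean_reducible a'b').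
  rewrite mulr0 subr0 mulf_neq0 // in H.
  by move: (H isT); congr reducible_row; rewrite ?rmorph0; ring.
have := euclidean_row_lower 0 a'b' g21N g12N.
rewrite rmorph0 mul0r addr0 => /EuclideanStep H.
have r3N c : kappa g21^-1 * r'' + kappa 0 <> kappa c.
  by apply: nonconst_affine; rewrite ?invr_eq0.
move/euclidean_reducible/reducible_row_swap: (H _ r3N).
congr reducible_row; rewrite 1?mulrC // [b' * _]mulrC; congr (_ + _).
have e : kappa g21^-1 * kappa g21 = 1 by rewrite -rmorphM mulVf // rmorph1.
by rewrite rmorph0 addr0 -[in RHS](mul1r r'') -e; ring.
Qed.

Hypothesis unit_const :
  forall u : R, unit_element u -> exists2 c, c != 0 & u = kappa c.

(** Apart from transvections, elementary matrices lie in GL_2(k): permutations clearly, diagonal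
    ones because units are constants. *)
Lemma reducible_row_elementary (r : 'rV[R]_2) (E : 'M[R]_2) :
  elementary_mx E -> reducible_row (r 0 0) (r 0 1) ->
  reducible_row ((r *m E) 0 0) ((r *m E) 0 1).
Proof.
rewrite !mulmx2E; move: (r 0 0) (r 0 1) => a b.
case=> [[i [j [x ij ->]]]|[i [j ->]]|[i [u uU ->]]] ab.
- have := ij; rewrite !mxE.
  case: (ord2P i) => ->; case: (ord2P j) => -> //= _;
    rewrite ?(mulr0n, mulr1n, mulr1, mulr0, addr0, add0r).
  + by rewrite addrC mulrC addrC; have := reducible_row_transvection x ab; rewrite addrC.
  + by have := reducible_row_transvection x (reducible_row_swap ab) => /reducible_row_swap;
      rewrite mulrC.
- rewrite !mxE; case: (ord2P i) => ->; case: (ord2P j) => ->;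
    rewrite ?(tpermL, tpermR, tperm1, permE) /= ?(mulr1, mulr0, addr0, add0r) //;
    exact: reducible_row_swap.
- have [c c0 uE] := unit_const uU; rewrite !mxE.
  case: (ord2P i) => -> /=; rewrite ?(mulr0n, mulr1n, mulr1, mulr0, addr0, add0r) uE.
  + have := reducible_row_mul (m11 := c) (m12 := 0) (m21 := 0) (m22 := 1) ab.
    rewrite rmorph0 rmorph1 !mulr0 !mulr1 addr0 add0r subr0; exact.
  + have := reducible_row_mul (m11 := 1) (m12 := 0) (m21 := 0) (m22 := c) ab.
    rewrite rmorph0 rmorph1 !mulr0 !mulr1 mul1r addr0 add0r subr0; exact.
Qed.

Lemma product_of_elementary_reducible (A : 'M[R]_2) :
  product_of_elementary A -> reducible_row (A 0 0) (A 0 1).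
Proof.
case=> s sE ->.
(* The induction peels off the leftmost factor, so the initial row has to vary; it is (1, 0) in the
   end. *)
have H (r : 'rV[R]_2) : reducible_row (r 0 0) (r 0 1) ->
    let B := \big[mulmx/1%:M]_(E <- s) E in
    reducible_row ((r *m B) 0 0) ((r *m B) 0 1).
  elim: s sE r => [|E s IH] sE r rr /=; first by rewrite big_nil mulmx1.
  rewrite big_cons mulmxA; apply: IH.
    by move=> E' E's; apply: sE; rewrite inE E's orbT.
  by apply: reducible_row_elementary => //; apply: sE; rewrite inE eqxx.
have /= := H (row 0 1%:M); rewrite -row_mul mul1mx !mxE; apply.
rewrite /= -(rmorph1 kappa); apply/euclidean_reducible/EuclideanUnit.
exact: oner_neq0.
Qed.

(* [dominates a b] stands for deg a > deg b. *)
Context (dominates : R -> R -> Prop).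
Hypothesis dominates0 : forall u, u != 0 -> dominates (kappa u) 0.
Hypothesis dominatesS : forall a b r,
  dominates a b -> (forall c, r <> kappa c) -> dominates (b + r * a) a.

(** The inverse of the GL_2(k) factor sends the first row of A back to a Euclidean row, whose first
    entry dominates the second. The coefficients are the columns of that inverse, written with the
    adjugate. *)
Lemma product_of_elementary_dominates (A : 'M[R]_2) :
    product_of_elementary A ->
  exists a b c d : k, [/\ (a != 0) || (b != 0), (c != 0) || (d != 0) &
    dominates (A 0 0 * kappa a + A 0 1 * kappa b)
              (A 0 0 * kappa c + A 0 1 * kappa d)].
Proof.
move=> /product_of_elementary_reducible.
move=> [s [t [g11 [g12 [g21 [g22 [st g0 E0 E1]]]]]]].
have domst : dominates s t by elim: st => *; [apply: dominates0|apply: dominatesS].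
pose D := g11 * g22 - g12 * g21; rewrite -/D in g0.
exists (g22 / D), (- g21 / D), (- g12 / D), (g11 / D); split.
- rewrite !mulf_eq0 oppr_eq0 invr_eq0 (negPf g0) !orbF -negb_and.
  by apply: contraNN g0 => /andP[/eqP a0 /eqP b0]; rewrite /D a0 b0; apply/eqP; ring.
- rewrite !mulf_eq0 oppr_eq0 invr_eq0 (negPf g0) !orbF -negb_and.
  by apply: contraNN g0 => /andP[/eqP a0 /eqP b0]; rewrite /D a0 b0; apply/eqP; ring.
have DV : kappa D * kappa D^-1 = 1 by rewrite -rmorphM divff // rmorph1.
have DE : kappa D = kappa g11 * kappa g22 - kappa g12 * kappa g21.
  by rewrite /D rmorphB !rmorphM.
rewrite E0 E1 !rmorphM !rmorphN /=.
congr dominates: domst.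
  by rewrite -[LHS]mulr1 -DV DE; ring.
by rewrite -[LHS]mulr1 -DV DE; ring.
Qed.

End EuclideanRows.

(** * The degree function given by a point at infinity *)

Section DegreeAtInfinity.

Context (k L : fieldType) (R : comPzRingType).
Context (iota : {rmorphism k -> L}) (kappa : {rmorphism k -> R}).
Context (n e : nat) (x y w : R) (theta al be : L).
Context (h : nat -> k) (g : nat -> nat -> k).

Let d := (n * e)%N.

Hypothesis n_gt1 : (1 < n)%N.
Hypothesis e_gt0 : (0 < e)%N.
Hypothesis xnE : x ^+ n = w - \sum_(j < n) kappa (h j) * (x ^+ j * y ^+ (n - j)).
Hypothesis weE : w ^+ e =
  - \sum_(j < d.+1) \sum_(l < d.+1) kappa (g j l) * (x ^+ j * y ^+ l).
Hypothesis g_deg : forall j l, (d <= j + l)%N -> g j l = 0.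
Hypothesis basis_free : forall (c : nat -> nat -> nat -> k) M,
  \sum_(i < e) \sum_(a < n) \sum_(b < M)
    kappa (c i a b) * (x ^+ a * y ^+ b * w ^+ i) = 0 ->
  forall i a b, (i < e)%N -> (a < n)%N -> (b < M)%N -> c i a b = 0.
Hypothesis theta_free : forall c : nat -> k,
  \sum_(a < n) iota (c a) * theta ^+ a = 0 ->
  forall a, (a < n)%N -> c a = 0.
(** [thetaE] compares the coefficients of t^(ne) in [xnE], where w has lower order; [beE] compares
    those of t^(e(d-1)) in [weE]. *)
Hypothesis thetaE : theta ^+ n = - \sum_(j < n) iota (h j) * theta ^+ j.
Hypothesis al_neq0 : al != 0.
(** In this form [be] may be 0 when e = 1, since only i = 0 then occurs. *)
Hypothesis be_neq0 : forall i, (i < e)%N -> be ^+ i != 0.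
Hypothesis beE : be ^+ e = - \sum_(j < d.+1) \sum_(l < d.+1)
  (if (j + l == d.-1)%N then iota (g j l) * (theta ^+ j * al ^+ d.-1) else 0).

Definition weight (i a b : nat) : nat := (e * (a + b) + d.-1 * i)%N.

Definition leadval (m i a b : nat) : L :=
  if weight i a b == m then theta ^+ a * al ^+ (a + b) * be ^+ i else 0.

(* In terms of x = theta al t^e + ..., y = al t^e + ..., w = be t^(ne-1) + ...,
   [leading P m r c] presents r as an element of degree at most m in which t^m
   has the coefficient c (possibly 0); P restricts the exponents of w and x. *)
Inductive leading (P : nat -> nat -> bool) (m : nat) : R -> L -> Prop :=
| Leading0 : leading P m 0 0
| LeadingD r s c c' of leading P m r c & leading P m s c' :
    leading P m (r + s) (c + c')
| LeadingMonomial u i a b of P i a & (weight i a b <= m)%N :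
    leading P m (kappa u * (x ^+ a * y ^+ b * w ^+ i)) (iota u * leadval m i a b).

(** Presentations with [total] exponents can be multiplied; those with [normal] exponents use only
    basis monomials and so determine their coefficients. *)
Let total (i a : nat) := true.
Let normal (i a : nat) := (i < e)%N && (a < n)%N.

Lemma leadingZ P m u r c :
  leading P m r c -> leading P m (kappa u * r) (iota u * c).
Proof.
elim=> {r c} [|r s c c' _ IHr _ IHs|v i a b Pia wm]; rewrite ?mulr0 ?mulrDr.
- exact: Leading0.
- exact: LeadingD.
- by rewrite (mulrA (kappa u)) (mulrA (iota u)) -!rmorphM; apply: LeadingMonomial.
Qed.

Lemma leadingN P m r c : leading P m r c -> leading P m (- r) (- c).
Proof. by move/(leadingZ (-1)); rewrite !rmorphN1 !mulN1r. Qed.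

Lemma leading_sum P m (I : finType) (Q : pred I) (f : I -> R) (c : I -> L) :
    (forall i, Q i -> leading P m (f i) (c i)) ->
  leading P m (\sum_(i | Q i) f i) (\sum_(i | Q i) c i).
Proof.
move=> H; elim/big_ind2: _ => //; first exact: Leading0.
by move=> *; apply: LeadingD.
Qed.

Lemma leading_ltn P m m' r c :
  leading P m r c -> (m < m')%N -> leading P m' r 0.
Proof.
move=> H mm'; elim: H => {r c} [|r s c c' _ IHr _ IHs|v i a b Pia wm].
- exact: Leading0.
- by rewrite -(addr0 0); apply: LeadingD.
- have -> : 0 = iota v * leadval m' i a b.
    by rewrite /leadval ltn_eqF ?mulr0 //; apply: leq_ltn_trans mm'.
  by apply: LeadingMonomial => //; apply: leq_trans wm (ltnW mm').
Qed.

Lemma leading_mul m l r s c c' : leading total m r c -> leading total l s c' ->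
  leading total (m + l) (r * s) (c * c').
Proof.
elim=> {r c} [|r r' c1 c2 _ IHr _ IHs|v i a b _ wm] Hs.
- by rewrite !mul0r; apply: Leading0.
- by rewrite !mulrDl; apply: LeadingD; [apply: IHr|apply: IHs].
elim: Hs => {s c'} [|r r' c1 c2 _ IHr _ IHs|v' i' a' b' _ wm'].
- by rewrite !mulr0; apply: Leading0.
- by rewrite !mulrDr; apply: LeadingD.
have wD : weight (i + i') (a + a') (b + b') = (weight i a b + weight i' a' b')%N.
  by rewrite /weight; ring.
have -> : kappa v * (x ^+ a * y ^+ b * w ^+ i) *
    (kappa v' * (x ^+ a' * y ^+ b' * w ^+ i')) =
    kappa (v * v') * (x ^+ (a + a') * y ^+ (b + b') * w ^+ (i + i')).
  by rewrite rmorphM !exprD; ring.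
have -> : iota v * leadval m i a b * (iota v' * leadval l i' a' b') =
    iota (v * v') * leadval (m + l) (i + i') (a + a') (b + b').
  rewrite /leadval wD; have [E|N] := eqVneq (weight i a b) m; last first.
    by rewrite [X in iota v * 0 * _ = _ * X]ifF; [rewrite mulr0 mul0r mulr0|]; last lia.
  have [E'|N'] := eqVneq (weight i' a' b') l; last first.
    by rewrite ltn_eqF ?mulr0 //; lia.
  by rewrite E E' eqxx rmorphM addnACA !exprD /=; ring.
by apply: LeadingMonomial; rewrite // wD leq_add.
Qed.

(** Rewriting w^e by [weE] and x^n by [xnE] never raises the weight, and [beE] and [thetaE] say that
    it preserves the leading coefficient. The rewriting terminates by lexicographic induction on m,
    i and a. *)
Lemma leading_monomial m i a b : (weight i a b <= m)%N ->
  leading normal m (x ^+ a * y ^+ b * w ^+ i) (leadval m i a b).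
Proof.
have d_gt1 : (1 < d)%N by rewrite /d; nia.
elim/ltn_ind: m i a b => m IHm.
elim/ltn_ind => i IHi; elim/ltn_ind => a IHa b wm.
have [wlt|wge] := ltnP (weight i a b) m.
  have m0 : (0 < m)%N by lia.
  have H := IHm m.-1 _ i a b _.
  rewrite /leadval ltn_eqF //.
  by apply: leading_ltn (H _ _) _; lia.
have wE : weight i a b = m by apply/eqP; rewrite eqn_leq wm.
have [i_ge|i_lt] := leqP e i.
  have -> : x ^+ a * y ^+ b * w ^+ i = - \sum_(j < d.+1) \sum_(l < d.+1)
      kappa (g j l) * (x ^+ (a + j) * y ^+ (b + l) * w ^+ (i - e)).
    rewrite -{1}(subnK i_ge) exprD weE !mulrN !mulrA; congr (- _).
    rewrite mulr_sumr; apply: eq_bigr => j _.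
    rewrite mulr_sumr; apply: eq_bigr => l _.
    by rewrite !exprD; ring.
  have -> : leadval m i a b = - \sum_(j < d.+1) \sum_(l < d.+1)
      iota (g j l) * leadval m (i - e) (a + j) (b + l).
    rewrite /leadval wE eqxx -[in LHS](subnK i_ge)
      [be ^+ _]exprD beE !mulrN mulrA; congr (- _).
    rewrite mulr_sumr; apply: eq_bigr => j _.
    rewrite mulr_sumr; apply: eq_bigr => l _.
    have [jl|jl] := leqP d (j + l).
      by rewrite g_deg // rmorph0 !mul0r; case: ifP; rewrite ?mulr0.
    have -> : (weight (i - e) (a + j) (b + l) == m) = (j + l == d.-1)%N.
      rewrite -wE /weight; apply/eqP/eqP; first by nia.
      by move=> E; have := subnK i_ge; nia.
    case: eqP => E; rewrite ?mulr0 //.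
    by rewrite -E addnACA !exprD; ring.
  apply/leadingN/leading_sum => j _; apply/leading_sum => l _.
  have [jl|jl] := leqP d (j + l).
    by rewrite g_deg // !rmorph0 !mul0r; apply: Leading0.
  apply: leadingZ; apply: IHi; first by lia.
  by rewrite -wE /weight; have := subnK i_ge; nia.
have [a_ge|a_lt] := leqP n a; last first.
  have := LeadingMonomial (P := normal) (m := m) 1 (i := i) (a := a) (b := b).
  by rewrite !rmorph1 !mul1r; apply => //; apply/andP.
have -> : x ^+ a * y ^+ b * w ^+ i = x ^+ (a - n) * y ^+ b * w ^+ i.+1 -
    \sum_(j < n) kappa (h j) * (x ^+ (a - n + j) * y ^+ (b + (n - j)) * w ^+ i).
  rewrite -{1}(subnK a_ge) exprD xnE mulrBr !mulrBl exprS; congr (_ - _).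
    by ring.
  rewrite mulr_sumr 2!mulr_suml; apply: eq_bigr => j _.
  by rewrite !exprD; ring.
have -> : leadval m i a b = 0 -
    \sum_(j < n) iota (h j) * leadval m i (a - n + j) (b + (n - j)).
  rewrite sub0r /leadval wE eqxx -[in X in X * _ * _](subnK a_ge) exprD
    thetaE mulrN !mulNr; congr (- _).
  rewrite mulr_sumr 2!mulr_suml; apply: eq_bigr => j _.
  have -> : (a - n + j + (b + (n - j)) = a + b)%N by have := ltn_ord j; lia.
  have -> : weight i (a - n + j) (b + (n - j)) == m.
    by rewrite -wE /weight; apply/eqP; have := ltn_ord j; nia.
  by rewrite !exprD; ring.
apply: LeadingD.
  (* Here i increases, but the weight drops to m - 1; this is why m is the outermost induction
     variable. *)
  have wlt : (weight i.+1 (a - n) b < m)%N.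
    by rewrite -wE /weight; have := subnK a_ge; rewrite /d in d_gt1 *; nia.
  by apply: leading_ltn (IHm m.-1 _ _ _ _ _) _; lia.
apply/leadingN/leading_sum => j _; apply: leadingZ; apply: IHa.
  by have := ltn_ord j; lia.
by rewrite -wE /weight; have := ltn_ord j; nia.
Qed.

Lemma leading_normal m r c : leading total m r c -> leading normal m r c.
Proof.
elim=> {r c} [|r s c c' _ IHr _ IHs|v i a b _ wm]; first exact: Leading0.
  exact: LeadingD.
by apply: leadingZ; apply: leading_monomial.
Qed.

Lemma leading_coefs m r v : leading normal m r v ->
  exists c : nat -> nat -> nat -> k,
  [/\ forall i a b, (m < weight i a b)%N -> c i a b = 0,
      r = \sum_(i < e) \sum_(a < n) \sum_(b < m.+1)
            kappa (c i a b) * (x ^+ a * y ^+ b * w ^+ i) &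
      v = \sum_(i < e) \sum_(a < n) \sum_(b < m.+1)
            iota (c i a b) * leadval m i a b].
Proof.
elim=> {r v} [|r s _ _ _ [c1 [H1 -> ->]] _ [c2 [H2 -> ->]]|u i a b /andP[ie an] wm].
- exists (fun _ _ _ => 0); split => //.
    by do 3! [rewrite big1 // => ? _]; rewrite rmorph0 mul0r.
  by do 3! [rewrite big1 // => ? _]; rewrite rmorph0 mul0r.
- exists (fun i a b => c1 i a b + c2 i a b); split.
  + by move=> i a b wm; rewrite H1 // H2 // addr0.
  + do 3! [rewrite -big_split; apply: eq_bigr => ? _].
    by rewrite rmorphD mulrDl.
  + do 3! [rewrite -big_split; apply: eq_bigr => ? _].
    by rewrite rmorphD mulrDl.
(* As e is positive, a weight of at most m bounds b by m, so the range of the inner sum is large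
   enough. *)
have bm : (b < m.+1)%N.
  by rewrite ltnS; apply: leq_trans wm; rewrite /weight; nia.
have pick (V : nmodType) (F : nat -> nat -> nat -> V) :
    \sum_(i' < e) \sum_(a' < n) \sum_(b' < m.+1)
      (if [&& i' == i :> nat, a' == a :> nat & b' == b :> nat]
       then F i' a' b' else 0) = F i a b.
  rewrite (bigD1 (Ordinal ie)) //= [X in _ + X]big1 ?addr0; last first.
    move=> i' /negPf N; do 2! [rewrite big1 // => ? _].
    by rewrite (_ : (i' == i :> nat) = false).
  rewrite (bigD1 (Ordinal an)) //= [X in _ + X]big1 ?addr0; last first.
    move=> a' /negPf N; rewrite big1 // => ? _.
    by rewrite (_ : (a' == a :> nat) = false) // andbF.
  rewrite (bigD1 (Ordinal bm)) //= [X in _ + X]big1 ?addr0 ?eqxx //.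
  by move=> b' /negPf N; rewrite (_ : (b' == b :> nat) = false) // !andbF.
exists (fun i' a' b' => if [&& i' == i, a' == a & b' == b] then u else 0).
split.
- by move=> i' a' b'; case: ifP => // /and3P[/eqP-> /eqP-> /eqP->]; lia.
- rewrite -[LHS](pick _ (fun i a b => kappa u * (x ^+ a * y ^+ b * w ^+ i))).
  do 3! [apply: eq_bigr => ? _].
  by case: ifP; rewrite ?rmorph0 ?mul0r.
- rewrite -[LHS](pick _ (fun i a b => iota u * leadval m i a b)).
  do 3! [apply: eq_bigr => ? _].
  by case: ifP; rewrite ?rmorph0 ?mul0r.
Qed.

(* As ne - 1 = -1 mod e, the weight of a normal monomial determines i, hence
   a + b, so that the leading coefficients of the normal monomials of a given
   weight are al^(a+b) * be^i times distinct powers theta^a with a < n. *)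
Lemma leadval_free (c : nat -> nat -> nat -> k) m :
    \sum_(i < e) \sum_(a < n) \sum_(b < m.+1) iota (c i a b) * leadval m i a b
      = 0 ->
  forall i a b, (i < e)%N -> (a < n)%N -> weight i a b = m -> c i a b = 0.
Proof.
have d_gt1 : (1 < d)%N by rewrite /d; nia.
move=> S0 i a b ie an wE; pose D := (a + b)%N.
have weight_inj i' a' b' : (i' < e)%N ->
    (weight i' a' b' == m) = (i' == i) && (a' + b' == D)%N.
  move=> i'e; apply/eqP/andP => [|[/eqP-> /eqP]]; last first.
    by rewrite -wE /weight /D => ->.
  rewrite -wE /weight -/D => E.
  suff ii' : i' = i.
    by split; apply/eqP => //; move: E; rewrite ii' => E; nia.
  have dE : d.-1.+1 = (n * e)%N by rewrite prednK // /d; nia.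
  (* Adding i + i' to both sides turns the factor ne - 1 into ne; modulo e only i = i' is left. *)
  have E' : (i + e * (a' + b') + (n * e) * i' = i' + e * D + (n * e) * i)%N.
    by rewrite -dE; nia.
  move/(congr1 (modn^~ e)): E'.
  rewrite -addnA -[in RHS]addnA -!mulnA.
  rewrite [in LHS](_ : i + _ = (a' + b' + n * i') * e + i)%N; last by nia.
  rewrite [in RHS](_ : i' + _ = (D + n * i) * e + i')%N; last by nia.
  by rewrite !modnMDl !modn_small.
(* The normal monomials of weight m are x^j y^(D-j) w^i; after division by al^D be^i the sum is a
   polynomial in theta with coefficients p. *)
pose p j := if (j <= D)%N then c i j (D - j)%N else 0.
suff /theta_free/(_ a an) : \sum_(j < n) iota (p j) * theta ^+ j = 0.
  by rewrite /p leq_addr addKn.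
have N : al ^+ D * be ^+ i != 0 by rewrite mulf_neq0 ?be_neq0 ?expf_neq0.
apply: (mulIf N); rewrite mul0r -[RHS]S0 (bigD1 (Ordinal ie)) //=.
rewrite [X in _ = _ + X]big1 ?addr0; last first.
  move=> i' /negPf N'; do 2! [rewrite big1 // => ? _].
  rewrite /leadval weight_inj // (_ : (i' == i :> nat) = false) //.
  by rewrite mulr0.
rewrite mulr_suml; apply: eq_bigr => j _; rewrite /p.
have [jD|jD] := leqP j D; last first.
  rewrite rmorph0 !mul0r big1 // => b' _.
  rewrite /leadval weight_inj // eqxx gtn_eqF ?mulr0 //.
  by apply: leq_trans jD _; apply: leq_addr.
have Dm : (D - j < m.+1)%N by rewrite ltnS -wE /weight -/D; nia.
rewrite (bigD1 (Ordinal Dm)) //= [X in _ = _ + X]big1 ?addr0.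
  by rewrite /leadval weight_inj // subnKC // !eqxx /=; ring.
move=> b' N'; rewrite /leadval weight_inj // eqxx /=.
case: eqP => E; rewrite ?mulr0 //; case/eqP: N'; apply: val_inj => /=.
by rewrite -E addKn.
Qed.

(** A normal presentation of 0 has only zero coefficients by [basis_free]. This makes leading
    coefficients well defined. *)
Lemma leading_eq0 m c : leading total m 0 c -> c = 0.
Proof.
move/leading_normal/leading_coefs => [f [_ S0 ->]].
have f0 := basis_free (esym S0).
do 3! [apply: big1 => ? _].
by rewrite f0 ?rmorph0 ?mul0r.
Qed.

Lemma leading_uniq m r c c' :
  leading total m r c -> leading total m r c' -> c = c'.
Proof.
move=> H /leadingN H'; have := LeadingD H H'.
by rewrite subrr => /leading_eq0/eqP; rewrite subr_eq0 => /eqP.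
Qed.

(** By [leadval_free] a vanishing leading coefficient kills every normal term of weight m, and the
    remaining terms have weight at most m - 1. *)
Lemma leading_descent m r : leading total m r 0 ->
  r = 0 \/ exists2 c, (0 < m)%N & leading total m.-1 r c.
Proof.
move/leading_normal/leading_coefs => [f [fm rE /esym/leadval_free v0]].
have [m0|m0] := posnP m.
  left; rewrite rE; apply: big1 => i _; apply: big1 => a _; apply: big1 => b _.
  have [/eqP E|N] := boolP (weight i a b == m).
    by rewrite v0 ?rmorph0 ?mul0r.
  by rewrite fm ?rmorph0 ?mul0r //; lia.
right; exists (\sum_(i < e) \sum_(a < n) \sum_(b < m.+1)
    iota (f i a b) * leadval m.-1 i a b) => //.
rewrite rE; apply: leading_sum => i _; apply: leading_sum => a _.
apply: leading_sum => b _.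
have [wm|wm] := leqP (weight i a b) m.-1; first exact: LeadingMonomial.
suff -> : f i a b = 0 by rewrite !rmorph0 !mul0r; apply: Leading0.
have [/eqP E|N] := boolP (weight i a b == m); first by rewrite v0.
by apply: fm; lia.
Qed.

Hypothesis xy_span : forall r : R, exists s : seq (k * nat * nat),
  r = \sum_(t <- s) kappa t.1.1 * (x ^+ t.1.2 * y ^+ t.2).

Lemma leading_span r : exists m c, leading total m r c.
Proof.
have [s ->] := xy_span r; elim: s => [|[[u a] b] s [m [c IH]]].
  by exists 0%N, 0; rewrite big_nil; apply: Leading0.
have H : leading total (weight 0 a b) (kappa u * (x ^+ a * y ^+ b))
    (iota u * leadval (weight 0 a b) 0 a b).
  have := LeadingMonomial (P := total) u (i := 0) (a := a) (b := b) isT (leqnn _).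
  by rewrite expr0 mulr1.
exists (weight 0 a b + m).+1, (0 + 0); rewrite big_cons; apply: LeadingD.
  by apply: leading_ltn H _; rewrite ltnS leq_addr.
by apply: leading_ltn IH _; rewrite ltnS leq_addl.
Qed.

Lemma leading_exists r : r <> 0 -> exists m c, c != 0 /\ leading total m r c.
Proof.
move=> r0; have [m [c]] := leading_span r.
elim/ltn_ind: m c => m IH c.
have [->|c0 H] := eqVneq c 0; last by exists m, c.
move/leading_descent => [//|[c' m0 H]].
by apply: (IH m.-1 _ c') => //; lia.
Qed.

Lemma leading_const r c : leading total 0 r c -> exists u, r = kappa u.
Proof.
have d_gt1 : (1 < d)%N by rewrite /d; nia.
elim=> {r c} [|r s c c' _ [u ->] _ [v ->]|u i a b _ wm].
- by exists 0; rewrite rmorph0.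
- by exists (u + v); rewrite rmorphD.
move: wm; rewrite leqn0 addn_eq0 !muln_eq0 addn_eq0.
have -> : (e == 0%N) = false by lia.
have -> : (d.-1 == 0%N) = false by lia.
rewrite /=.
by case/andP=> /andP[/eqP-> /eqP->] /eqP->; exists u; rewrite !expr0 !mulr1.
Qed.

Lemma leading_kappa u : leading total 0 (kappa u) (iota u).
Proof.
have := LeadingMonomial (P := total) (m := 0) u (i := 0) (a := 0) (b := 0).
by rewrite /leadval /weight addn0 !muln0 eqxx !expr0 !mulr1; apply.
Qed.

Lemma leading_nonconst r : (forall c, r <> kappa c) ->
  exists m c, [/\ c != 0, (0 < m)%N & leading total m r c].
Proof.
move=> rN; have r0 : r <> 0 by rewrite -(rmorph0 kappa).
have [m [c [c0 H]]] := leading_exists r0; exists m, c; split=> //.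
by rewrite lt0n; apply/eqP => m0; move: H; rewrite m0 => /leading_const[u /rN].
Qed.

(** Degrees add, since leading coefficients multiply in the field L. A nonconstant u has positive
    degree, whereas u v = 1 has degree 0. *)
Lemma unit_kappa (u : R) : unit_element u -> exists2 c, c != 0 & u = kappa c.
Proof.
case=> v uv.
have one_neq0 : (1 : R) <> 0.
  move=> E; have := leading_kappa 1; rewrite rmorph1 E => /leading_eq0/eqP.
  by rewrite rmorph1 oner_eq0.
have [[c uE]|/forallNP uN] := pselect (exists c, u = kappa c).
  exists c => //; apply: contra_notN one_neq0 => /eqP c0.
  by rewrite -uv uE c0 rmorph0 mul0r.
have [m [c [c0 m0 H]]] := leading_nonconst uN.
have v0 : v <> 0 by move=> E; apply: one_neq0; rewrite -uv E mulr0.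
have [l [c' [c'0 H']]] := leading_exists v0.
have := leading_mul H H'; rewrite uv => H1.
have := leading_ltn (leading_kappa 1) (ltn_addr l m0); rewrite rmorph1 => H2.
by have /eqP := leading_uniq H1 H2; rewrite mulf_eq0 (negPf c0) (negPf c'0).
Qed.

(** The coefficient 0 of s at t^m encodes deg s < m and includes s = 0, which needs no degree of its
    own. *)
Definition higher_degree (r s : R) : Prop :=
  exists m c, [/\ c != 0, leading total m r c & leading total m s 0].

Lemma higher_degree0 u : u != 0 -> higher_degree (kappa u) 0.
Proof.
move=> u0; exists 0%N, (iota u); split; [|exact: leading_kappa|exact: Leading0].
by rewrite fmorph_eq0.
Qed.

Lemma higher_degree_step a b r : higher_degree a b ->
  (forall c, r <> kappa c) -> higher_degree (b + r * a) a.
Proof.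
case=> m [c [c0 Ha Hb]] /leading_nonconst[l [c' [c'0 l0 Hr]]].
exists (l + m)%N, (c' * c); split; first by rewrite mulf_neq0.
  rewrite -(add0r (c' * c)); apply: LeadingD; last exact: leading_mul.
  by apply: leading_ltn Hb _; lia.
by apply: leading_ltn Ha _; lia.
Qed.

Lemma higher_degree_irrefl m r s c c' : c != 0 -> c' != 0 ->
  leading total m r c -> leading total m s c' -> ~ higher_degree r s.
Proof.
move=> c0 c'0 Hr Hs [l [c1 [c10 Hr' Hs']]].
have [ml|lm|ml] := ltngtP m l.
- by case/eqP: c10; apply: leading_uniq Hr' (leading_ltn Hr ml).
- by case/eqP: c0; apply: leading_uniq Hr (leading_ltn Hr' lm).
- by case/eqP: c'0; apply: leading_uniq Hs _; rewrite ml.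
Qed.

Lemma non_elementary_matrix_exists (f : nat -> k) (D : nat) (psi : R) :
    f D != 0 -> y * psi = - \sum_(j < D.+1) kappa (f j) * x ^+ j ->
  exists2 A : 'M[R]_2, invertible_mx A & ~ product_of_elementary A.
Proof.
move=> fD; set phi := \sum_(j < D.+1) _ => psiE.
(* This makes f_D theta^D al^D a nonzero leading coefficient of phi, in degree eD. *)
have theta0 : theta != 0.
  apply/eqP => t0; pose p j := if j == 1%N then 1 : k else 0.
  have /theta_free/(_ 1%N n_gt1) : \sum_(j < n) iota (p j) * theta ^+ j = 0.
    apply: big1 => -[[|j] jn] _; rewrite /p /= ?rmorph0 ?mul0r //.
    by rewrite t0 exprS mul0r mulr0.
  by move/eqP; rewrite oner_eq0.
have xX j m : (e * j <= m)%N -> leading total m (x ^+ j) (leadval m 0 j 0).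
  move=> jm; have := LeadingMonomial (P := total) (m := m) 1 (i := 0) (a := j)
    (b := 0) isT.
  by rewrite /weight muln0 !addn0 !rmorph1 !mul1r !expr0 !mulr1; apply.
have [N [c [c0 Hphi]]] : exists N c, c != 0 /\ leading total N phi c.
  exists (e * D)%N, (0 + iota (f D) * leadval (e * D) 0 D 0); split.
    rewrite add0r /leadval /weight muln0 !addn0 eqxx expr0 mulr1.
    by rewrite !mulf_neq0 ?expf_neq0 // fmorph_eq0.
  rewrite /phi big_ord_recr /=; apply: LeadingD; last first.
    by apply: leadingZ; apply: xX.
  suff: leading total (e * D) (\sum_(j < D) kappa (f j) * x ^+ j)
    (\sum_(j < D) (0 : L)) by rewrite big1_eq.
  apply: leading_sum => j _; rewrite -(mulr0 (iota (f j))); apply: leadingZ.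
  have jD : (e * j < e * D)%N by rewrite ltn_pmul2l.
  exact: leading_ltn (xX j _ (leqnn _)) jD.
pose A : 'M[R]_2 := \matrix_(i, j) if i == 0 then
  (if j == 0 then 1 + x * phi else y * phi) else
  (if j == 0 then x ^+ 2 * psi else 1 - x * phi).
(* B is the adjugate of A, and the determinant is 1 because y psi = - phi. *)
pose B : 'M[R]_2 := \matrix_(i, j) if i == 0 then
  (if j == 0 then 1 - x * phi else - (y * phi)) else
  (if j == 0 then - (x ^+ 2 * psi) else 1 + x * phi).
have detE : (y * phi) * (x ^+ 2 * psi) = - (x * phi) ^+ 2.
  by transitivity (x ^+ 2 * phi * (y * psi)); [ring|rewrite psiE; ring].
exists A.
  have ext (P Q : 'M[R]_2) : P 0 0 = Q 0 0 -> P 0 1 = Q 0 1 ->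
      P 1 0 = Q 1 0 -> P 1 1 = Q 1 1 -> P = Q.
    move=> e00 e01 e10 e11; apply/matrixP => i j.
    by case: (ord2P i) => ->; case: (ord2P j) => ->.
  exists B; split; apply: ext; rewrite mulmx2E !mxE /= ?(mulr1n, mulr0n);
    ring: detE.
move/(product_of_elementary_dominates unit_kappa higher_degree0 higher_degree_step).
case=> a [b [a' [b' [ab ab' H]]]].
move: H; rewrite !mxE /=.
have Hx : leading total e x (theta * al).
  have := LeadingMonomial (P := total) (m := e) 1 (i := 0) (a := 1) (b := 0).
  rewrite /leadval /weight muln0 addn0 muln1 eqxx !rmorph1 !mul1r !expr1 !expr0.
  by rewrite !mulr1; apply.
have Hy : leading total e y al.
  have := LeadingMonomial (P := total) (m := e) 1 (i := 0) (a := 0) (b := 1).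
  rewrite /leadval /weight muln0 addn0 muln1 eqxx !rmorph1 !mul1r !expr1 !expr0.
  by rewrite ?mulr1 ?mul1r; apply.
(* The leading coefficient is (u theta + v) al c, and 1, theta are independent over k as n > 1.
   Hence all nonzero combinations have degree e + N and none dominates another. *)
have comb (u v : k) : (u != 0) || (v != 0) -> exists2 c', c' != 0 &
    leading total (e + N) ((1 + x * phi) * kappa u + y * phi * kappa v) c'.
  move=> uv; exists ((iota u * theta + iota v) * al * c).
    rewrite !mulf_neq0 //; apply: contraTneq uv => E.
    pose p j := if j == 0%N then v else if j == 1%N then u else 0.
    have /theta_free p0 : \sum_(j < n) iota (p j) * theta ^+ j = 0.
      rewrite -(subnKC n_gt1) !big_ord_recl big1 ?addr0 /p /=.
        by rewrite expr0 expr1 mulr1 addrC.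
      by move=> i _; rewrite rmorph0 mul0r.
    have v0 := p0 0%N (ltnW n_gt1); have u0 := p0 1%N n_gt1.
    by rewrite /p /= in v0 u0; rewrite v0 u0 eqxx.
  have -> : (1 + x * phi) * kappa u + y * phi * kappa v =
      kappa u + (kappa u * (x * phi) + kappa v * (y * phi)) by ring.
  have -> : (iota u * theta + iota v) * al * c =
      0 + (iota u * (theta * al * c) + iota v * (al * c)) by ring.
  apply: LeadingD.
    by apply: leading_ltn (leading_kappa u) _; rewrite addn_gt0 e_gt0.
  by apply: LeadingD; apply: leadingZ; apply: leading_mul.
have [c1 c10 H1] := comb a b ab; have [c2 c20 H2] := comb a' b' ab'.
exact: higher_degree_irrefl c10 c20 H1 H2.
Qed.

End DegreeAtInfinity.

(** * Homogenization and minimal polynomials *)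

Section Homogenization.

Context (k : fieldType) (A : comPzRingType) (kappa : {rmorphism k -> A}).
Context (x y : A).

(** This is y^N p(x/y) when p has degree at most N; coefficients beyond N are dropped, whence the
    size bounds in the lemmas on products. *)
Definition homogenize (N : nat) (p : {poly k}) : A :=
  \sum_(j < N.+1) kappa p`_j * (x ^+ j * y ^+ (N - j)).

Lemma homogenizeC N c : homogenize N c%:P = kappa c * y ^+ N.
Proof.
rewrite /homogenize big_ord_recl big1 ?addr0.
  by rewrite coefC expr0 mul1r subn0.
by move=> j _; rewrite coefC rmorph0 mul0r.
Qed.

Lemma homogenizeMX N (p : {poly k}) c : (size p <= N.+1)%N ->
  homogenize N.+1 (p * 'X + c%:P) = x * homogenize N p + kappa c * y ^+ N.+1.
Proof.
move=> sp; rewrite /homogenize big_ord_recl [RHS]addrC; congr (_ + _).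
  by rewrite coefD coefMX coefC eqxx add0r expr0 mul1r subn0.
rewrite mulr_sumr; apply: eq_bigr => j _.
by rewrite coefD coefMX coefC addr0 subSS exprS; ring.
Qed.

Lemma homogenizeD N p q :
  homogenize N (p + q) = homogenize N p + homogenize N q.
Proof.
rewrite /homogenize -big_split; apply: eq_bigr => j _.
by rewrite coefD rmorphD mulrDl.
Qed.

Lemma homogenizeZ N c p : homogenize N (c *: p) = kappa c * homogenize N p.
Proof.
rewrite /homogenize mulr_sumr; apply: eq_bigr => j _.
by rewrite coefZ rmorphM -mulrA.
Qed.

Lemma homogenize_addn N M (p : {poly k}) : (size p <= M.+1)%N ->
  homogenize (N + M) p = y ^+ N * homogenize M p.
Proof.
move=> sp; rewrite /homogenize (addnC N) -addSn big_split_ord /= [X in _ + X]big1.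
  rewrite addr0 mulr_sumr; apply: eq_bigr => j _.
  by rewrite [(M + N)%N]addnC -addnBA -1?ltnS // exprD; ring.
by move=> j _; rewrite nth_default ?rmorph0 ?mul0r // (leq_trans sp) ?leq_addr.
Qed.

Lemma homogenizeM N M (p q : {poly k}) : (size p <= N.+1)%N -> (size q <= M.+1)%N ->
  homogenize (N + M) (p * q) = homogenize N p * homogenize M q.
Proof.
move=> + sq; elim/poly_ind: p N => [|p c IH] N sp.
  by rewrite mul0r -{1 2}(scale0r 0) !homogenizeZ rmorph0 !mul0r.
(* Only when p = 0 can N be 0, so that no variable can be split off. *)
have [p0|pN] := eqVneq p 0.
  rewrite p0 mul0r add0r mul_polyC homogenizeZ homogenize_addn //.
  by rewrite homogenizeC mulrA.
have {}sp : (size p < N.+1)%N.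
  move: sp; rewrite size_MXaddC (negPf pN) andFb; exact.
case: N sp => [|N] sp; first by rewrite ltnS size_poly_leq0 (negPf pN) in sp.
rewrite ltnS in sp.
rewrite homogenizeMX // mulrDl mul_polyC homogenizeD homogenizeZ.
rewrite (homogenize_addn N.+1 sq) [RHS]mulrDl -(mulrA (kappa c)); congr (_ + _).
rewrite mulrAC -[p * q * 'X]addr0 -polyC0 addSn homogenizeMX.
  by rewrite rmorph0 mul0r addr0 IH // mulrA.
apply: leq_trans (size_polyMleq _ _) _.
by move: sp sq; case: (size p) => [|a]; case: (size q) => [|b] //=; lia.
Qed.

Lemma homogenizeX N (p : {poly k}) e : (size p <= N.+1)%N ->
  homogenize (N * e) (p ^+ e) = homogenize N p ^+ e.
Proof.
move=> sp; elim: e => [|e IH].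
  by rewrite muln0 !expr0 homogenizeC rmorph1 mulr1.
rewrite mulnS !exprS homogenizeM ?IH //.
apply: leq_trans (size_poly_exp_leq _ _) _; rewrite ltnS leq_mul2r.
by apply/orP; right; lia.
Qed.

End Homogenization.

(** * Minimal polynomials and expansions in powers of a monic polynomial *)

Section MinimalPolynomial.

Context (k L : fieldType) (iota : {rmorphism k -> L}) (theta : L).

(** Among the nonzero polynomials vanishing at theta one of least size divides the others, since the
    remainder also vanishes at theta and is smaller. *)
Lemma minimal_poly_exists : algebraicOver iota theta ->
  exists2 h : {poly k}, h \is monic &
    forall p, root (map_poly iota p) theta = (h %| p).
Proof.
case=> p0 p0N rp0.
pose Q s := `[< exists p : {poly k},
  [/\ p != 0, root (map_poly iota p) theta & size p = s] >].
have exQ : exists s, Q s by exists (size p0); apply/asboolP; exists p0.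
case: (ex_minnP exQ) => s /asboolP[p [pN rp ps]] smin.
have lN : lead_coef p != 0 by rewrite lead_coef_eq0.
exists ((lead_coef p)^-1 *: p); first by rewrite monicE lead_coefZ mulVf.
move=> q; rewrite dvdpZl ?invr_eq0 //; apply/idP/idP => [rq|]; last first.
  by case/dvdpP => r ->; rewrite rmorphM rootM rp orbT.
apply/modp_eq0P/eqP; apply: contraT => mN.
have /smin : Q (size (q %% p)).
  apply/asboolP; exists (q %% p); split=> //.
  have /(congr1 (map_poly iota)) := divp_eq q p.
  rewrite rmorphD rmorphM /= => E; move: rq.
  by rewrite E /root hornerD hornerM (rootP rp) mulr0 add0r.
by rewrite -ps leqNgt ltn_modp pN.
Qed.

End MinimalPolynomial.

(** The induction runs over all divisors q of f. A nonconstant q has a root t, also a root of f, so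
    q vanishes at theta and h divides q; the quotient is a smaller divisor of f. *)
Lemma power_of_minimal_poly (k : fieldType) (L : closedFieldType)
    (iota : {rmorphism k -> L}) (theta : L) (h f : {poly k}) :
    (forall p, root (map_poly iota p) theta = (h %| p)) -> f != 0 ->
    (forall (t : L) (p : {poly k}), root (map_poly iota f) t ->
       root (map_poly iota p) t -> root (map_poly iota p) theta) ->
  exists c e, f = c *: h ^+ e.
Proof.
move=> hP f0 conj.
have : f %| f by [].
move: {1 3}f => q; elim: {q}(size q) {-2}q (leqnn (size q)) => [|s IH] q.
  by rewrite size_poly_leq0 => /eqP-> /dvd0pP/eqP; rewrite (negPf f0).
move=> sq qf; have [q1|qn1] := eqVneq (size q) 1%N.
  have /size_poly1P[c _ ->] : size q == 1%N by rewrite q1.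
  by exists c, 0%N; rewrite expr0 alg_polyC.
have : size (map_poly iota q) != 1%N by rewrite size_map_poly.
case/closed_rootP => t qt.
have ft : root (map_poly iota f) t.
  by case/dvdpP: qf => r ->; rewrite rmorphM rootM qt orbT.
have := conj t q ft qt; rewrite hP => /dvdpP[r qE].
have q0 : q != 0 by apply: contraNneq f0 => q0; move: qf; rewrite q0 => /dvd0pP->.
have [r0 h0] : r != 0 /\ h != 0.
  by move: q0; rewrite qE mulf_eq0 negb_or => /andP.
have h1 : (1 < size h)%N.
  rewrite ltn_neqAle eq_sym lt0n size_poly_eq0 h0 andbT.
  apply/negP => /size_poly1P[c c0 hE].
  have := hP 1; rewrite rmorph1 /root hornerC oner_eq0.
  by rewrite hE dvdp1 size_polyC c0.
have rf : r %| f by apply: dvdp_trans qf; rewrite qE dvdp_mulr.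
have sr : (size r <= s)%N by move: sq h1; rewrite qE size_mul //;
  move: (size r) (size h); lia.
have [c [e rE]] := IH r sr rf.
by exists c, e.+1; rewrite qE rE exprSr scalerAl.
Qed.

(** A nonzero top digit P_e gives a term of size greater than ne, which the lower terms, of total
    size at most ne, cannot cancel. *)
Lemma adic_expansion (A : idomainType) (h : {poly A}) (n e : nat)
    (P : nat -> {poly A}) : h \is monic -> size h = n.+1 ->
    (forall i, (size (P i) <= n)%N) ->
  (size (\sum_(i < e) P i * h ^+ i)%R <= n * e)%N /\
  (\sum_(i < e) P i * h ^+ i = 0 -> forall i, (i < e)%N -> P i = 0).
Proof.
move=> hm sh sP; elim: e => [|e [IHs IH0]].
  by rewrite big_ord0 size_poly0.
have sh' : size (h ^+ e) = (n * e).+1.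
  have -> : n = (size h).-1 by rewrite sh.
  by rewrite -size_exp prednK // size_poly_gt0 monic_neq0 ?monic_exp.
have sM : P e != 0 -> size (P e * h ^+ e) = (size (P e) + n * e)%N.
  by move=> Pe0; rewrite size_Mmonic ?monic_exp // sh' addnS.
rewrite big_ord_recr /=; split.
  apply: leq_trans (size_polyD _ _) _; rewrite geq_max; apply/andP; split.
    by apply: leq_trans IHs _; rewrite leq_mul2l leqnSn orbT.
  have [->|/sM->] := eqVneq (P e) 0; first by rewrite mul0r size_poly0.
  by rewrite mulnS leq_add2r.
move=> S0; have Pe0 : P e = 0.
  apply/eqP/negPn/negP => PeN; have := sM PeN.
  move/eqP: S0; rewrite addr_eq0 => /eqP; move: IHs => /[swap] ->.
  rewrite size_polyN => /[swap] ->.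
  by rewrite -[X in (_ <= X)%N]add0n leq_add2r leqn0 size_poly_eq0 (negPf PeN).
move: S0; rewrite Pe0 mul0r addr0 => /IH0 H i.
by rewrite ltnS leq_eqVlt => /orP[/eqP->|/H].
Qed.

(** * The curve at infinity *)

Section TernaryForm.

Context (k : fieldType) (d : nat) (H : {mpoly k[3]}).
Hypothesis H_homog : H \is d.-homog.

Definition mnm3 (j l : nat) : 'X_{1..3} :=
  [multinom nth 0%N [:: j; l; d - j - l]%N i | i < 3].

(** The guard gives 0 where the subtraction in [mnm3] truncates, without appeal to homogeneity. *)
Definition form_coef (j l : nat) : k :=
  if (j + l <= d)%N then H@_(mnm3 j l) else 0.

Lemma form_expansion : H =
  \sum_(j < d.+1) \sum_(l < d.+1) form_coef j l *: 'X_[mnm3 j l].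
Proof.
apply/mpolyP => m; rewrite (raddf_sum (mcoeff m)) /=.
under eq_bigr => j _ do rewrite (raddf_sum (mcoeff m)) /=.
under eq_bigr => j _ do under eq_bigr => l _ do rewrite mcoeffZ mcoeffX.
have mdegE3 : mdeg m = (m 0%R + m 1%R + m ord_max)%N.
  rewrite mdegE !big_ord_recl big_ord0 addn0 addnA.
  by congr (m _ + m _ + m _)%N; apply: val_inj.
have mnm3_eq j l : (j + l <= d)%N -> (mnm3 j l == m) =
    [&& j == m 0%R, l == m 1%R & mdeg m == d].
  move=> jl; apply/eqP/and3P => [<-|[/eqP-> /eqP-> /eqP E]].
    split; rewrite ?mnmE //= mdegE !big_ord_recl big_ord0 !mnmE /=.
    by apply/eqP; lia.
  apply/mnmP => i; rewrite mnmE; case: i => [[|[|[|]]]] // ? /=.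
  - by congr (m _); apply: val_inj.
  - by congr (m _); apply: val_inj.
  - have -> : (d - m 0%R - m 1%R = m ord_max)%N by lia.
    by congr (m _); apply: val_inj.
have [md|mNd] := eqVneq (mdeg m) d; last first.
  rewrite (dhomog_nemf_coeff H_homog) // big1 // => j _; rewrite big1 // => l _.
  rewrite /form_coef; case: ifP => [jl|_]; last by rewrite mul0r.
  by rewrite mnm3_eq // (negPf mNd) !andbF mulr0.
have m0d : (m 0%R < d.+1)%N by lia.
have m1d : (m 1%R < d.+1)%N by lia.
have ifcoef (j l : nat) : form_coef j l * (mnm3 j l == m)%:R =
    if (j == m 0%R) && (l == m 1%R) then H@_m else 0.
  rewrite /form_coef; case: ifP => jl; last first.
    by rewrite mul0r; case: ifP => // /andP[/eqP j0 /eqP l1]; lia.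
  have [<-|] := eqVneq (mnm3 j l) m.
    by rewrite !mnmE /= !eqxx mulr1.
  by rewrite mnm3_eq // md eqxx andbT => /negPf->; rewrite mulr0.
under eq_bigr => j _ do under eq_bigr => l _ do rewrite ifcoef.
rewrite (bigD1 (Ordinal m0d)) //= [X in _ = _ + X]big1 ?addr0; last first.
  move=> j /negPf N; rewrite big1 // => l _.
  by rewrite (_ : (j == m 0%R :> nat) = false).
rewrite (bigD1 (Ordinal m1d)) //= [X in _ = _ + X]big1 ?addr0 ?eqxx //.
by move=> l /negPf N; rewrite (_ : (l == m 1%R :> nat) = false) // andbF.
Qed.

Lemma mmap_form (B : comNzRingType) (phi : {rmorphism k -> B}) (v : 'I_3 -> B) :
  mmap phi v H = \sum_(j < d.+1) \sum_(l < d.+1)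
    phi (form_coef j l) * (v 0 ^+ j * v 1 ^+ l * v ord_max ^+ (d - j - l)).
Proof.
rewrite {1}form_expansion raddf_sum; apply: eq_bigr => j _.
rewrite raddf_sum; apply: eq_bigr => l _ /=.
rewrite mmapZ mmapX /mmap1 !big_ord_recl big_ord0 mulr1 !mnmE /= !mulrA.
by congr (_ * v _ ^+ _ * v _ ^+ _ * v _ ^+ _); apply: val_inj.
Qed.

Lemma eval_form (L : fieldType) (iota : {rmorphism k -> L}) (v : 'rV[L]_3) :
  eval_at (map_mpoly iota H) v = \sum_(j < d.+1) \sum_(l < d.+1)
    iota (form_coef j l) * (v 0 0 ^+ j * v 0 1 ^+ l * v 0 ord_max ^+ (d - j - l)).
Proof.
rewrite -(mmap_form iota (v 0)) /eval_at {1}(mpolyE H).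
rewrite (raddf_sum (map_mpoly iota)) (raddf_sum (meval _)) /mmap.
by apply: eq_bigr => m _ /=; rewrite map_mpolyZ map_mpolyX mevalZ mevalX.
Qed.

Lemma eval_mderiv_form (L : fieldType) (iota : {rmorphism k -> L})
    (v : 'rV[L]_3) (i : 'I_3) :
  eval_at (mderiv i (map_mpoly iota H)) v = \sum_(j < d.+1) \sum_(l < d.+1)
    iota (form_coef j l) * ((mnm3 j l i)%:R *
      \prod_(i' < 3) v 0 i' ^+ ((mnm3 j l - U_(i))%MM i')).
Proof.
rewrite /eval_at {1}form_expansion.
rewrite (raddf_sum (map_mpoly iota)) (raddf_sum (mderiv i)) (raddf_sum (meval _)).
apply: eq_bigr => j _.
rewrite (raddf_sum (map_mpoly iota)) (raddf_sum (mderiv i)) (raddf_sum (meval _)).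
apply: eq_bigr => l _ /=.
by rewrite map_mpolyZ map_mpolyX mderivZ mderivX !mevalZ mevalX.
Qed.

End TernaryForm.

(** * The form at infinity and smoothness at its multiple roots *)

Section PointsAtInfinity.

Context (k : fieldType) (d : nat) (H : {mpoly k[3]}).

Local Notation cf := (form_coef d H).

Definition form_at_infinity : {poly k} := \poly_(j < d.+1) cf j (d - j).

Lemma form_coef_gt j l : (d < j + l)%N -> cf j l = 0.
Proof. by rewrite /form_coef ltnNge => /negPf->. Qed.

Lemma form_split (B : comPzRingType) (phi : {rmorphism k -> B}) (x y : B) :
  \sum_(j < d.+1) \sum_(l < d.+1) phi (cf j l) * (x ^+ j * y ^+ l) =
  homogenize phi x y d form_at_infinity +
  \sum_(j < d.+1) \sum_(l < d.+1)
    phi (if (j + l < d)%N then cf j l else 0) * (x ^+ j * y ^+ l).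
Proof.
rewrite /homogenize -big_split; apply: eq_bigr => j _ /=.
have jd : (d - j < d.+1)%N by lia.
rewrite (bigD1 (Ordinal jd)) //= [in RHS](bigD1 (Ordinal jd)) //=.
have jd' : (j <= d)%N by have := ltn_ord j; lia.
rewrite coef_poly ltn_ord subnKC // ltnn rmorph0 mul0r add0r; congr (_ + _).
apply: eq_bigr => l lN; congr (phi _ * _).
case: ltnP => // dj; apply: form_coef_gt.
rewrite ltn_neqAle dj andbT; apply: contra lN => /eqP E.
by apply/eqP/val_inj => /=; lia.
Qed.

(** For l < d - j the power of 0 vanishes; for l > d - j the truncated exponent is 0, but the
    coefficient vanishes. *)
Lemma sum_at_infinity (L : fieldType) (iota : {rmorphism k -> L})
    (F : nat -> L) j : (j <= d)%N ->
  \sum_(l < d.+1) iota (cf j l) * (F l * 0 ^+ (d - j - l)) =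
  iota (cf j (d - j)) * F (d - j)%N.
Proof.
move=> jd; have jd' : (d - j < d.+1)%N by lia.
rewrite (bigD1 (Ordinal jd')) //= subnn expr0 mulr1 big1 ?addr0 // => l lN.
have [lt|ge] := ltnP (j + l) d.
  have -> : (d - j - l = (d - j - l).-1.+1)%N by lia.
  by rewrite exprS mul0r !mulr0.
rewrite form_coef_gt ?rmorph0 ?mul0r // ltn_neqAle ge andbT.
by apply: contra lN => /eqP E; apply/eqP/val_inj => /=; lia.
Qed.

Hypothesis H_homog : H \is d.-homog.

Context (kbar : closedFieldType) (iota : {rmorphism k -> kbar}).

Definition point_at_infinity (L : fieldType) (a b : L) : 'rV[L]_3 :=
  \row_i [:: a; b; 0]`_i.

Lemma eval_at_infinity (a b : kbar) :
  eval_at (map_mpoly iota H) (point_at_infinity a b) =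
  homogenize iota a b d form_at_infinity.
Proof.
rewrite (eval_form H_homog) !mxE /=; apply: eq_bigr => j _.
have jd : (j <= d)%N by have := ltn_ord j; lia.
by rewrite (sum_at_infinity iota (fun l => a ^+ j * b ^+ l) jd) coef_poly ltn_ord.
Qed.

Lemma root_at_infinity (t : kbar) : root (map_poly iota form_at_infinity) t ->
  at_infinity iota H (point_at_infinity t 1).
Proof.
move=> rt; split; last by rewrite mxE.
split.
  by apply/eqP => /rowP/(_ 1); rewrite !mxE /=; apply/eqP; rewrite oner_eq0.
rewrite eval_at_infinity -(rootP rt) (@horner_coef_wide _ d.+1).
  by apply: eq_bigr => j _; rewrite expr1n mulr1 coef_map.
by rewrite size_map_poly size_poly.
Qed.

(** At (t : 1 : 0) the X-derivative is f'(t) and, by Euler's relation, the Y-derivative is d f(t) -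
    t f'(t). Both vanish at a multiple root, so the Z-derivative, which is this sum, does not. *)
Lemma smooth_at_infinity (t : kbar) : (0 < d)%N ->
    root (map_poly iota form_at_infinity) t ->
    root (map_poly iota form_at_infinity^`()) t ->
    (exists i, eval_at (mderiv i (map_mpoly iota H)) (point_at_infinity t 1)
       != 0) ->
  \sum_(j < d.+1) \sum_(l < d.+1)
    (if (j + l == d.-1)%N then iota (cf j l) * t ^+ j else 0) != 0.
Proof.
move=> d_gt0 rt rt' [i]; rewrite (eval_mderiv_form H_homog).
under eq_bigr => j _ do under eq_bigr => l _ do
  rewrite !big_ord_recl big_ord0 !mxE !mnmBE !mnm1E !mnmE /= !expr1n.
have f0 : \sum_(j < d.+1) iota (cf j (d - j)) * t ^+ j = 0.
  rewrite -[RHS](rootP rt) (@horner_coef_wide _ d.+1).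
    by apply: eq_bigr => j _; rewrite coef_map coef_poly ltn_ord.
  by rewrite size_map_poly size_poly.
have f'0 : \sum_(j < d.+1) iota (cf j (d - j)) * (j%:R * t ^+ j.-1) = 0.
  rewrite -[RHS](rootP rt') /form_at_infinity poly_def raddf_sum raddf_sum.
  rewrite horner_sum; apply: eq_bigr => j _ /=.
  rewrite derivZ derivXn linearZ /= hornerZ raddfMn /= map_polyXn hornerMn hornerXn.
  by rewrite mulr_natl.
case: i => [[|[|[|]]]] // i3.
- rewrite [X in X != 0 -> _](_ : _ = 0) ?eqxx // -[RHS]f'0.
  apply: eq_bigr => j _; have jd : (j <= d)%N by have := ltn_ord j; lia.
  rewrite -(sum_at_infinity iota (fun _ => j%:R * t ^+ j.-1) jd).
  apply: eq_bigr => l _; rewrite -!val_eqE /= subn0 subn1.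
  by ring.
- rewrite [X in X != 0 -> _](_ : _ = 0) ?eqxx //.
  transitivity (d%:R * \sum_(j < d.+1) iota (cf j (d - j)) * t ^+ j -
    t * \sum_(j < d.+1) iota (cf j (d - j)) * (j%:R * t ^+ j.-1)); last first.
    by rewrite f0 f'0 !mulr0 subr0.
  rewrite !mulr_sumr -sumrB; apply: eq_bigr => j _.
  have jd : (j <= d)%N by have := ltn_ord j; lia.
  transitivity (iota (cf j (d - j)) * ((d - j)%:R * t ^+ j)).
    rewrite -(sum_at_infinity iota (fun l => l%:R * t ^+ j) jd).
    apply: eq_bigr => l _; rewrite -!val_eqE /= !subn0.
    by ring.
  rewrite natrB //; case: (nat_of_ord j) => [|m]; first by rewrite !expr0; ring.
  by rewrite exprS /=; ring.
(* On Z = 0 the Z-derivative keeps only the terms with Z-exponent 1, that is j + l = d - 1. *)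
- rewrite [X in X != 0 -> _](_ : _ = \sum_(j < d.+1) \sum_(l < d.+1)
    (if (j + l == d.-1)%N then iota (cf j l) * t ^+ j else 0)) //.
  apply: eq_bigr => j _; apply: eq_bigr => l _.
  rewrite -!val_eqE /= subn0 subn1 mul1r mulr1.
  have [jl|jl] := ltnP d (j + l).
    by rewrite form_coef_gt // rmorph0 !mul0r; case: ifP.
  have [/eqP E|N] := boolP (j + l == d.-1)%N.
    have -> : (d - j - l = 1)%N by lia.
    by rewrite /= mul1r expr0 mulr1.
  case: (posnP (d - j - l)) => [->|lt]; first by rewrite mul0r mulr0.
  have -> : ((d - j - l).-1 = (d - j - l).-2.+1)%N by lia.
  by rewrite exprS mul0r !mulr0.
Qed.

End PointsAtInfinity.

(** * The affine coordinate ring *)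

Fact quot_pi_zmod_morphism (A : comNzRingType) (a : A) :
  zmod_morphism (@quot_pi A a).
Proof.
move=> u v; apply/eqP; rewrite -subr_eq opprK -quot_piD subrK.
exact: eqxx.
Qed.

Fact quot_pi_monoid_morphism (A : comNzRingType) (a : A) :
  monoid_morphism (@quot_pi A a).
Proof. by split; [|move=> u v; rewrite quot_piM]. Qed.

HB.instance Definition _ (A : comNzRingType) (a : A) :=
  GRing.isZmodMorphism.Build A (quot_ring a) (@quot_pi A a)
    (quot_pi_zmod_morphism a).
HB.instance Definition _ (A : comNzRingType) (a : A) :=
  GRing.isMonoidMorphism.Build A (quot_ring a) (@quot_pi A a)
    (quot_pi_monoid_morphism a).

Lemma homogenize_rmorph (k : fieldType) (A B : comPzRingType)
    (phi : {rmorphism k -> A})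
    (psi : {rmorphism A -> B}) (x y : A) N (p : {poly k}) :
  homogenize (psi \o phi) (psi x) (psi y) N p = psi (homogenize phi x y N p).
Proof.
rewrite /homogenize rmorph_sum; apply: eq_bigr => j _.
by rewrite !rmorphM !rmorphXn.
Qed.

Lemma rmorph_monomial (k : fieldType) (A B : comPzRingType)
    (phi : {rmorphism k -> A}) (psi : {rmorphism A -> B}) (x y : A)
    (p : {poly k}) N u i a b :
  psi (phi u * (x ^+ a * y ^+ b * homogenize phi x y N p ^+ i)) =
  (psi \o phi) u * (psi x ^+ a * psi y ^+ b *
    homogenize (psi \o phi) (psi x) (psi y) N p ^+ i).
Proof. by rewrite !rmorphM !rmorphXn homogenize_rmorph. Qed.

Section AffineCoordinateRing.

Context (k : fieldType) (d : nat) (H : {mpoly k[3]}).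
Hypothesis H_homog : H \is d.-homog.

Local Notation cf := (form_coef d H).
Local Notation R := (affine_coordinate_ring H).

Definition affine_const : {rmorphism k -> R} :=
  (@quot_pi _ (dehomogenize H) \o @mpolyC 2 k).
Definition affine_x : R := quot_pi (dehomogenize H) 'X_0.
Definition affine_y : R := quot_pi (dehomogenize H) 'X_1.

Lemma dehomogenize_form : dehomogenize H =
  \sum_(j < d.+1) \sum_(l < d.+1) (cf j l)%:MP * ('X_0 ^+ j * 'X_1 ^+ l).
Proof.
rewrite /dehomogenize /comp_mpoly (mmap_form H_homog (@mpolyC 2 k)).
apply: eq_bigr => j _; apply: eq_bigr => l _.
by rewrite !(tnth_nth 0) /= expr1n mulr1.
Qed.

Lemma affine_relation :
  \sum_(j < d.+1) \sum_(l < d.+1)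
    affine_const (cf j l) * (affine_x ^+ j * affine_y ^+ l) = 0.
Proof.
transitivity (quot_pi (dehomogenize H) (dehomogenize H)).
  rewrite {2}dehomogenize_form rmorph_sum; apply: eq_bigr => j _.
  rewrite rmorph_sum; apply: eq_bigr => l _.
  by rewrite !rmorphM !rmorphXn.
rewrite -(rmorph0 (@quot_pi _ (dehomogenize H))); apply/quot_pi_eq.
by exists 1; rewrite subr0 mul1r.
Qed.

Lemma affine_span (r : R) : exists s : seq (k * nat * nat),
  r = \sum_(t <- s) affine_const t.1.1 * (affine_x ^+ t.1.2 * affine_y ^+ t.2).
Proof.
have [p ->] := quot_pi_surj r.
exists [seq (p@_m, m 0, m 1) | m : 'X_{1..2} <- msupp p].
rewrite big_map {1}(mpolyE p) rmorph_sum; apply: eq_bigr => m _ /=.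
rewrite -mul_mpolyC rmorphM; congr (_ * _).
rewrite mpolyXE_id !big_ord_recl big_ord0 mulr1 rmorphM !rmorphXn.
by congr (quot_pi _ 'X_ _ ^+ m _ * quot_pi _ 'X_ _ ^+ m _); apply: val_inj.
Qed.

(** In k[Y][X] a combination of the monomials lifts to an expansion in powers of the homogenization
    of h, monic of X-degree n, so it has X-degree less than ne = d. A multiple of F of X-degree less
    than d is 0, and the digits of the expansion of 0 are 0. *)
Lemma affine_basis_free (h : {poly k}) (n e : nat) :
    cf d 0 != 0 -> h \is monic -> size h = n.+1 -> d = (n * e)%N ->
  let w := homogenize affine_const affine_x affine_y n h in
  forall (c : nat -> nat -> nat -> k) M,
  \sum_(i < e) \sum_(a < n) \sum_(b < M)
    affine_const (c i a b) * (affine_x ^+ a * affine_y ^+ b * w ^+ i) = 0 ->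
  forall i a b, (i < e)%N -> (a < n)%N -> (b < M)%N -> c i a b = 0.
Proof.
move=> cd hm sh dE w c M S0.
pose PP : {mpoly k[2]} := \sum_(i < e) \sum_(a < n) \sum_(b < M)
  (c i a b)%:MP * ('X_0 ^+ a * 'X_1 ^+ b *
    homogenize (@mpolyC 2 k) 'X_0 'X_1 n h ^+ i).
have : quot_pi (dehomogenize H) PP = quot_pi (dehomogenize H) 0.
  rewrite rmorph0 -[RHS]S0 /PP.
  do 3! [rewrite rmorph_sum; apply: eq_bigr => ? _].
  exact: rmorph_monomial.
case/quot_pi_eq => C; rewrite subr0 => PE.
pose phi := (@polyC {poly k} \o @polyC k) : {rmorphism k -> {poly {poly k}}}.
(* X becomes the outer variable and Y the inner one. *)
pose Th : {rmorphism {mpoly k[2]} -> {poly {poly k}}} :=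
  mmap phi (fun i : 'I_2 => if i == 0 then 'X else 'X%:P).
have Th0 : Th 'X_0 = 'X by rewrite /Th /= mmapX mmap1U.
have Th1 : Th 'X_1 = 'X%:P by rewrite /Th /= mmapX mmap1U.
have ThC u : Th u%:MP = u%:P%:P by rewrite /Th /= mmapC.
pose hh := homogenize phi 'X 'X%:P n h.
pose Q i : {poly {poly k}} := \poly_(a < n) \poly_(b < M) c i a b.
have ThP : Th PP = \sum_(i < e) Q i * hh ^+ i.
  rewrite /PP rmorph_sum; apply: eq_bigr => i _.
  rewrite /Q poly_def mulr_suml rmorph_sum; apply: eq_bigr => a _.
  rewrite poly_def scaler_suml mulr_suml rmorph_sum; apply: eq_bigr => b _.
  rewrite !rmorphM !rmorphXn Th0 Th1 ThC -homogenize_rmorph Th0 Th1.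
  have -> : homogenize (Th \o @mpolyC 2 k) 'X 'X%:P n h = hh.
    by apply: eq_bigr => j _; rewrite /= [mmap _ _ _]ThC.
  by rewrite -!mul_polyC !rmorphM !rmorphXn /=; ring.
have hhE : hh = \poly_(j < n.+1) (h`_j *: 'X^(n - j)).
  rewrite poly_def; apply: eq_bigr => j _.
  by rewrite -mul_polyC -mul_polyC !rmorphM rmorphXn /=; ring.
have hhm : hh \is monic /\ size hh = n.+1.
  have hn : h`_n = 1 by move/monicP: hm; rewrite lead_coefE sh.
  have sz : size hh = n.+1.
    by rewrite hhE size_poly_eq // hn subnn expr0 scale1r oner_neq0.
  by rewrite monicE lead_coefE sz hhE coef_poly ltnSn hn subnn expr0 scale1r.
have sQ i : (size (Q i) <= n)%N by apply: size_poly.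
have [szP /(_ _)P0] := adic_expansion e hhm.1 hhm.2 sQ.
have ThF : Th (dehomogenize H) = \poly_(j < d.+1) \poly_(l < d.+1) cf j l.
  rewrite dehomogenize_form rmorph_sum poly_def; apply: eq_bigr => j _.
  rewrite rmorph_sum poly_def scaler_suml; apply: eq_bigr => l _.
  rewrite !rmorphM !rmorphXn Th0 Th1 ThC -!mul_polyC !rmorphM !rmorphXn /=.
  by ring.
have sF : (d < size (Th (dehomogenize H)))%N.
  have : (Th (dehomogenize H))`_d != 0.
    rewrite ThF coef_poly ltnSn; apply/eqP => /(congr1 (fun p : {poly k} => p`_0)).
    by rewrite coef_poly coef0 /=; apply/eqP.
  by apply: contraR; rewrite -leqNgt => sF; rewrite nth_default.
have C0 : Th C = 0.
  apply/eqP/negPn/negP => CN.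
  have FN : Th (dehomogenize H) != 0 by rewrite -size_poly_gt0; lia.
  move: szP; rewrite -ThP PE rmorphM size_mul // -dE.
  have : (0 < size (Th C))%N by rewrite size_poly_gt0.
  by move: sF; move: (size (Th C)) (size (Th (dehomogenize H))) => s t; lia.
move: ThP; rewrite PE rmorphM C0 mul0r => /esym/P0 Q0 i a b ie an bM.
have := congr1 (fun p : {poly {poly k}} => p`_a`_b) (Q0 i ie).
by rewrite /Q !coef_poly an coef_poly bM !coef0.
Qed.

End AffineCoordinateRing.

(** * The relations satisfied by x, y, w and by their leading coefficients *)

Section CurveRelations.

Context (k : fieldType) (d : nat) (H : {mpoly k[3]}).
Context (h : {poly k}) (n e : nat) (c : k).
Hypothesis h_monic : h \is monic.
Hypothesis size_h : size h = n.+1.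
Hypothesis dE : d = (n * e)%N.
Hypothesis c_neq0 : c != 0.
Hypothesis fE : form_at_infinity d H = c *: h ^+ e.

Local Notation cf := (form_coef d H).

Definition subleading_coef (j l : nat) : k :=
  if (j + l < d)%N then c^-1 * cf j l else 0.

Lemma lead_coef_minimal : h`_n = 1.
Proof. by move/monicP: h_monic; rewrite lead_coefE size_h. Qed.

Lemma minimal_poly_root (L : fieldType) (iota : {rmorphism k -> L}) (theta : L) :
  root (map_poly iota h) theta ->
  theta ^+ n = - \sum_(j < n) iota h`_j * theta ^+ j.
Proof.
move/rootP; rewrite (@horner_coef_wide _ n.+1) ?size_map_poly ?size_h //.
rewrite big_ord_recr /= coef_map /= lead_coef_minimal rmorph1 mul1r => /eqP.
rewrite addrC addr_eq0 => /eqP->; congr (- _).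
by apply: eq_bigr => j _; rewrite coef_map.
Qed.

(* When e > 1, the constants solve be^e = - delta al^(ne-1), where smoothness
   gives delta <> 0; when e = 1, be may vanish. *)
Lemma leading_coefficients_exist (L : closedFieldType)
    (iota : {rmorphism k -> L}) (theta : L) :
    H \is d.-homog -> (0 < n)%N -> (0 < e)%N -> root (map_poly iota h) theta ->
    (exists i, eval_at (mderiv i (map_mpoly iota H))
       (point_at_infinity theta 1) != 0) ->
  exists al be : L, [/\ al != 0, forall i, (i < e)%N -> be ^+ i != 0 &
    be ^+ e = - \sum_(j < d.+1) \sum_(l < d.+1)
      (if (j + l == d.-1)%N
       then iota (subleading_coef j l) * (theta ^+ j * al ^+ d.-1) else 0)].
Proof.
move=> H_homog n0 e0 rh smooth.
have d0 : (0 < d)%N by rewrite dE muln_gt0 n0.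
pose gamma := \sum_(j < d.+1) \sum_(l < d.+1)
  (if (j + l == d.-1)%N then iota (cf j l) * theta ^+ j else 0).
pose delta := iota c^-1 * gamma.
have deltaE al : \sum_(j < d.+1) \sum_(l < d.+1) (if (j + l == d.-1)%N
    then iota (subleading_coef j l) * (theta ^+ j * al ^+ d.-1) else 0) =
    delta * al ^+ d.-1.
  rewrite /delta /gamma mulr_sumr mulr_suml; apply: eq_bigr => j _.
  rewrite mulr_sumr mulr_suml; apply: eq_bigr => l _.
  case: eqP => [E|_]; last by rewrite mulr0 mul0r.
  have jl : (j + l < d)%N by lia.
  by rewrite /subleading_coef jl rmorphM; ring.
have [e1|e1] := leqP e 1.
  exists 1, (- delta); split; first exact: oner_neq0.
    move=> i ie; have -> : i = 0%N by lia.
    by rewrite expr0 oner_neq0.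
  have -> : e = 1%N by lia.
  by rewrite deltaE expr1n mulr1 expr1.
(* For e > 1 the square of h divides f, so theta is a multiple root of f and smoothness applies. *)
have gamma0 : gamma != 0.
  have h2 : h ^+ e = h * (h * h ^+ e.-2).
    by rewrite -!exprS; congr (_ ^+ _); lia.
  apply: smooth_at_infinity => //; rewrite fE h2.
    by rewrite map_polyZ rmorphM /= /root hornerZ hornerM (rootP rh) mul0r mulr0.
  rewrite derivZ derivM map_polyZ rmorphD !rmorphM /= /root hornerZ hornerD.
  by rewrite !hornerM derivM rmorphD !rmorphM /= (rootP rh) !(mul0r, mulr0, addr0).
have delta0 : delta != 0 by rewrite mulf_neq0 // fmorph_eq0 invr_eq0.
(* With al = - delta the right-hand side is (- delta)^(ne), the e-th power of (- delta)^n. *)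
exists (- delta), ((- delta) ^+ n); split; rewrite ?oppr_eq0 //.
  by move=> i _; rewrite !expf_neq0 // oppr_eq0.
by rewrite deltaE -exprM -dE -[in LHS](prednK d0) exprS mulNr.
Qed.

Context (A : comPzRingType) (kappa : {rmorphism k -> A}) (x y : A).
Hypothesis xy_relation :
  \sum_(j < d.+1) \sum_(l < d.+1) kappa (cf j l) * (x ^+ j * y ^+ l) = 0.

Lemma minimal_relation : x ^+ n =
  homogenize kappa x y n h - \sum_(j < n) kappa h`_j * (x ^+ j * y ^+ (n - j)).
Proof.
rewrite /homogenize big_ord_recr /= lead_coef_minimal rmorph1 mul1r subnn expr0.
by rewrite mulr1 addrAC subrr add0r.
Qed.

(** As homogenization is multiplicative, w^e is the part of degree d of F/c at (x, y), and F(x, y) =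
    0 expresses it by the lower terms. *)
Lemma power_relation : homogenize kappa x y n h ^+ e =
  - \sum_(j < d.+1) \sum_(l < d.+1)
      kappa (subleading_coef j l) * (x ^+ j * y ^+ l).
Proof.
rewrite -homogenizeX ?size_h // -dE.
have -> : h ^+ e = c^-1 *: form_at_infinity d H.
  by rewrite fE scalerA mulVf // scale1r.
rewrite homogenizeZ; move: xy_relation; rewrite form_split => /eqP.
rewrite addr_eq0 => /eqP->.
rewrite mulrN mulr_sumr; congr (- _); apply: eq_bigr => j _.
rewrite mulr_sumr; apply: eq_bigr => l _.
rewrite [LHS]mulrA -rmorphM /subleading_coef.
by case: ifP; rewrite ?mulr0.
Qed.

Lemma ordinate_relation :
  y * (\sum_(j < d.+1) \sum_(l < d) kappa (cf j l.+1) * (x ^+ j * y ^+ l)) =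
  - \sum_(j < d.+1) kappa (cf j 0) * x ^+ j.
Proof.
apply/eqP; rewrite -addr_eq0; apply/eqP; rewrite -[RHS]xy_relation addrC.
rewrite mulr_sumr -big_split; apply: eq_bigr => j _ /=.
rewrite big_ord_recl expr0 mulr1 mulr_sumr; congr (_ + _).
by apply: eq_bigr => l _; rewrite exprS; ring.
Qed.

End CurveRelations.

Theorem theorem4p5 (k : fieldType) (kbar : closedFieldType)
    (iota : {rmorphism k -> kbar})
    (hperfect : perfect_field k)
    (hclosure : is_algebraic_closure iota)
    (d : nat) (hd : (2 <= d)%N)
    (H : {mpoly k[3]})
    (hC : smooth_plane_curve iota d H)
    (hrat : forall P : 'rV[kbar]_3,
        at_infinity iota H P -> ~ rational_point iota P)
    (hconj : forall P Q : 'rV[kbar]_3,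
        at_infinity iota H P -> at_infinity iota H Q ->
        conjugate_points iota P Q) :
  exists2 A : 'M[affine_coordinate_ring H]_2,
    invertible_mx A & ~ product_of_elementary A.
Proof.
have [H_homog _ smooth] := hC.
have map_point (a b : k) : map_mx iota (point_at_infinity a b) =
    point_at_infinity (iota a) (iota b).
  by apply/rowP => -[[|[|[|]]]] // i; rewrite !mxE /= ?rmorph0.
have rat_point (a b : k) :
    ~ at_infinity iota H (point_at_infinity (iota a) (iota b)).
  move=> /hrat; apply; exists (point_at_infinity a b), 1; first exact: oner_neq0.
  by rewrite map_point scale1r.
(* Otherwise (1 : 0 : 0) would be a rational point at infinity. Hence f has degree exactly d, and F
   is, up to a constant, monic in X. *)
have cd : form_coef d H d 0 != 0.
  apply/eqP => cd; apply: (rat_point 1 0); rewrite rmorph1 rmorph0.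
  split; last by rewrite mxE.
  split.
    by apply/eqP => /rowP/(_ 0); rewrite !mxE; apply/eqP; rewrite oner_eq0.
  rewrite (eval_at_infinity H_homog) /homogenize big_ord_recr big1 /=.
    by rewrite coef_poly ltnSn subnn cd rmorph0 mul0r addr0.
  by move=> j _; rewrite expr0n subn_eq0 leqNgt ltn_ord !mulr0.
have size_f : size (form_at_infinity d H) = d.+1 by rewrite size_poly_eq // subnn.
have f0 : form_at_infinity d H != 0 by rewrite -size_poly_gt0 size_f.
have /closed_rootP[theta f_theta] :
    size (map_poly iota (form_at_infinity d H)) != 1%N.
  by rewrite size_map_poly size_f eqSS; lia.
have theta_inf := root_at_infinity H_homog f_theta.
have [h h_monic hP] := minimal_poly_exists (hclosure theta).
have h_theta : root (map_poly iota h) theta by rewrite hP.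
have conj (t : kbar) (p : {poly k}) :
    root (map_poly iota (form_at_infinity d H)) t ->
    root (map_poly iota p) t -> root (map_poly iota p) theta.
  move=> ft pt; have := hconj _ _ (root_at_infinity H_homog ft) theta_inf.
  (* The second coordinates show that the scaling factor b is 1, so sigma t = theta; sigma fixes the
     coefficients of p. *)
  case=> sigma [_ sigma_iota] [b _ E].
  have := congr1 (fun v : 'rV_3 => v 0 1) E.
  rewrite !mxE /= rmorph1 mulr1 => b1.
  have := congr1 (fun v : 'rV_3 => v 0 0) E.
  rewrite !mxE /= -b1 mul1r => <-.
  have -> : map_poly iota p = map_poly sigma (map_poly iota p).
    by rewrite -map_poly_comp; apply: eq_map_poly => u /=; rewrite sigma_iota.
  by rewrite /root horner_map (rootP pt) rmorph0.
have [c [e fE]] := power_of_minimal_poly hP f0 conj.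
have c0 : c != 0 by apply: contraNneq f0 => c0; rewrite fE c0 scale0r.
have size_h : size h = (size h).-1.+1 by rewrite prednK // size_poly_gt0 monic_neq0.
move: (size h).-1 size_h => n size_h.
have dE : d = (n * e)%N.
  by have := size_exp h e; rewrite -(size_scale _ c0) -fE size_f size_h.
have theta_free (u : nat -> k) : \sum_(a < n) iota (u a) * theta ^+ a = 0 ->
    forall a, (a < n)%N -> u a = 0.
  move=> S0 a an; have : root (map_poly iota (\poly_(i < n) u i)) theta.
    rewrite /root (@horner_coef_wide _ n) ?size_map_poly ?size_poly //.
    apply/eqP; rewrite -[RHS]S0; apply: eq_bigr => i _.
    by rewrite coef_map coef_poly ltn_ord.
  rewrite hP => hdvd; have p0 : \poly_(i < n) u i = 0.
    apply/eqP; apply: contraTT hdvd => /dvdp_leq hle; apply/negP => /hle.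
    by rewrite size_h leqNgt ltnS size_poly.
  by have := congr1 (fun p : {poly k} => p`_a) p0; rewrite coef_poly an coef0.
(* If n were 1, theta = - h_0 would lie in k and (theta : 1 : 0) would be rational; n = 0
   contradicts d >= 2. *)
have n_gt1 : (1 < n)%N.
  rewrite ltnNge; apply/negP => n1.
  have n1' : n = 1%N by case: (posnP n) => [n0|]; [move: hd; rewrite dE n0|lia].
  have := minimal_poly_root h_monic size_h h_theta.
  rewrite n1' big_ord_recl big_ord0 expr1 expr0 mulr1 addr0 -rmorphN => tE.
  by apply: (rat_point (- h`_0) 1); rewrite rmorph1 -tE.
have e_gt0 : (0 < e)%N by case: (posnP e) => // e0; move: hd; rewrite dE e0 muln0.
subst d.
have [al [be [al0 be0 beE]]] := leading_coefficients_exist h_monic size_h erefl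
  c0 fE H_homog (ltnW n_gt1) e_gt0 h_theta (smooth _ theta_inf.1).
have relation := affine_relation H_homog.
have g_deg j l : (n * e <= j + l)%N -> subleading_coef (n * e) H c j l = 0.
  by move=> jl; rewrite /subleading_coef ltnNge jl.
(* Here phi(X) = F(X, 0), whose coefficient of X^d is nonzero by [cd], and psi is the quotient of F
   - phi by Y, evaluated in R. *)
apply: (non_elementary_matrix_exists n_gt1 e_gt0
  (minimal_relation h_monic size_h (affine_const H) (affine_x H) (affine_y H))
  (power_relation size_h erefl c0 fE relation) g_deg
  (affine_basis_free H_homog cd h_monic size_h erefl) theta_free
  (minimal_poly_root h_monic size_h h_theta) al0 be0 beE (affine_span (H := H))
  (f := fun j => form_coef (n * e) H j 0) cd (ordinate_relation relation)).
Qed.
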